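(* Let $k$ be a field, let $k(Q,\mathcal A)$ be a generalized path algebra and let $\mathcal M=(A_i,{}_iM_j)$ be its corresponding $k$-pre-modulation. Then the category $\mathrm{Rep}(\mathcal M)$ is equivalent to the category $\mathrm{Mod}_{k(Q,\mathcal A)}$ of right $k(Q,\mathcal A)$-modules, and the category $\mathrm{rep}(\mathcal M)$ is equivalent to the category $\mathrm{mod}_{k(Q,\mathcal A)}$ of finitely generated right $k(Q,\mathcal A)$-modules.
   Context: Let $Q=(Q_0,Q_1)$ be a finite quiver and $\mathcal A=\{A_i\mid i\in Q_0\}$ a family of finite-dimensional unital $k$-algebras. Let $\Omega(i,j)$ be the set of arrows from $i$ to $j$, $A_0=\prod_{i\in Q_0}A_i$, ${}_iM_j=A_i\Omega(i,j)A_j$ the free $A_i$-$A_j$-bimodule (i.e. free $A_i\otimes_kA_j^{op}$-module) with basis $\Omega(i,j)$, and $M=\bigoplus_{(i,j)\in Q_0\times Q_0}{}_iM_j$, an $A_0$-$A_0$-bimodule. The generalized path algebra is the tensor algebra $k(Q,\mathcal A)=T(A_0,M)=\bigoplus_{n\ge0}M^{\otimes_{A_0}n}$, with $M^{\otimes_{A_0}0}=A_0$. The corresponding $k$-pre-modulation of $k(Q,\mathcal A)$ is $\mathcal M=(A_i,{}_iM_j)$, over the induced valued quiver: vertex set $Q_0$, a unique oriented edge $i\to j$ whenever ${}_iM_j\ne0$, with valuation $(d_{ij},d_{ji})$, $d_{ij}=\mathrm{rank}(({}_iM_j)_{A_j})$, $d_{ji}=\mathrm{rank}({}_{A_i}({}_iM_j))$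 (rank = minimal number of generators). A representation of $\mathcal M$ is $\mathcal V=(V_i,{}_j\varphi_i)$ with a right $A_i$-module $V_i$ for each $i\in Q_0$ and an $A_j$-homomorphism ${}_j\varphi_i:V_i\otimes_{A_i}{}_iM_j\to V_j$ for each oriented edge $i\to j$; it is finitely generated if each $V_i$ is finitely generated over $A_i$. A morphism $(V_i,{}_j\varphi_i)\to(U_i,{}_j\psi_i)$ is a family of $A_i$-homomorphisms $\alpha_i:V_i\to U_i$ with $\alpha_j\circ{}_j\varphi_i={}_j\psi_i\circ(\alpha_i\otimes\mathrm{id}_{{}_iM_j})$ for each oriented edge $i\to j$. $\mathrm{Rep}(\mathcal M)$ (resp. $\mathrm{rep}(\mathcal M)$) is the category of all (resp. finitely generated) representations.
   Formalization: The equivalence of rep(M) with mod is stated only for quivers Q without oriented cycles (loops included); it fails otherwise, e.g. for one loop with A = k, where the algebra is k[x]. The algebras A_i are taken to be nonzero. *)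

(* Defs.v *)
From HB Require Import structures.
From mathcomp Require Import all_boot all_algebra falgebra.
From mathcomp Require Import boolp.

Set Implicit Arguments.
Unset Strict Implicit.
Unset Printing Implicit Defensive.

Import GRing.Theory.
Local Open Scope ring_scope.
Local Open Scope quotient_scope.

(* Right R-modules are left modules over the converse ring R^c. *)
Notation rmodType R := (GRing.Lmodule.type (GRing.converse R)).
Definition rscale (R : pzRingType) (V : rmodType R) (v : V) (a : R) : V :=
  (a : GRing.converse R) *: v.

Section Tensor.
Variables (S : Type) (V W : zmodType) (va : V -> S -> V) (wa : S -> W -> W).

(* The abelian group V (x)_S W is presented by formal sums of pairs (v, w).  No
   integer coefficients are needed: (- v, w) will be the opposite of (v, w). *)
Inductive tens_rel : seq (V * W) -> seq (V * W) -> Prop :=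
| TensRefl s : tens_rel s s
| TensSym s t : tens_rel s t -> tens_rel t s
| TensTrans s t u : tens_rel s t -> tens_rel t u -> tens_rel s u
| TensCat s s' t t' :
    tens_rel s s' -> tens_rel t t' -> tens_rel (s ++ t) (s' ++ t')
| TensC s t : tens_rel (s ++ t) (t ++ s)
| Tens0l w : tens_rel [:: (0, w)] [::]
| TensDl v v' w : tens_rel [:: (v + v', w)] [:: (v, w); (v', w)]
| TensDr v w w' : tens_rel [:: (v, w + w')] [:: (v, w); (v, w')]
| TensBal v a w : tens_rel [:: (va v a, w)] [:: (v, wa a w)].

Definition tens_relb (s t : seq (V * W)) := `[< tens_rel s t >].

Lemma tens_relb_refl : reflexive tens_relb.
Proof. by move=> s; apply/asboolP; apply: TensRefl. Qed.
Lemma tens_relb_sym : symmetric tens_relb.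
Proof. by move=> s t; apply/asboolP/asboolP; apply: TensSym. Qed.
Lemma tens_relb_trans : transitive tens_relb.
Proof.
move=> t s u /asboolP st /asboolP tu; apply/asboolP.
exact: TensTrans st tu.
Qed.

Canonical tens_equiv :=
  EquivRel tens_relb tens_relb_refl tens_relb_sym tens_relb_trans.

Definition tensor := {eq_quot tens_equiv}.
HB.instance Definition _ := Choice.on tensor.
HB.instance Definition _ := EqQuotient.on tensor.

Lemma tens_piP (s t : seq (V * W)) :
  (\pi_tensor s = \pi_tensor t) <-> tens_rel s t.
Proof.
by split=> [/eqmodP/asboolP //|st]; apply/eqmodP/asboolP.
Qed.

Lemma tens_repr (s : seq (V * W)) : tens_rel (repr (\pi_tensor s)) s.
Proof. by apply/tens_piP; rewrite reprK. Qed.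

Definition tens_add (x y : tensor) : tensor := \pi_tensor (repr x ++ repr y).
Definition tens_opp (x : tensor) : tensor :=
  \pi_tensor [seq (- p.1, p.2) | p <- repr x].

Lemma tens_addE s t :
  tens_add (\pi_tensor s) (\pi_tensor t) = \pi_tensor (s ++ t).
Proof.
by apply/tens_piP; exact (TensCat (tens_repr s) (tens_repr t)).
Qed.

Lemma tens_addA : associative tens_add.
Proof.
elim/quotW=> s; elim/quotW=> t; elim/quotW=> u.
by rewrite (tens_addE t u) (tens_addE s t) (tens_addE s) (tens_addE _ u) catA.
Qed.

Lemma tens_addC : commutative tens_add.
Proof. by move=> x y; apply/tens_piP/TensC. Qed.

Lemma tens_add0 : left_id (\pi_tensor [::]) tens_add.
Proof. by elim/quotW=> s; rewrite (tens_addE [::] s). Qed.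

HB.instance Definition _ :=
  GRing.isNmodule.Build tensor tens_addA tens_addC tens_add0.

Lemma tens_addN : left_inverse (0 : tensor) tens_opp +%R.
Proof.
move=> x; rewrite /tens_opp -{2}[x]reprK.
elim: (repr x) => [|[v w] s IHs] /=; first exact: add0r.
have piD u t : \pi_tensor (u :: t) = \pi_tensor [:: u] + \pi_tensor t.
  by rewrite -cat1s -tens_addE.
rewrite piD [X in _ + X]piD addrACA IHs addr0 [LHS]tens_addE.
apply/tens_piP; apply: TensTrans (TensSym (TensDl _ _ _)) _.
by rewrite addNr; apply: Tens0l.
Qed.

HB.instance Definition _ := GRing.Nmodule_isZmodule.Build tensor tens_addN.

Definition tens (v : V) (w : W) : tensor := \pi_tensor [:: (v, w)].

Lemma tens_pi s : \pi_tensor s = \sum_(p <- s) tens p.1 p.2.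
Proof.
elim: s => [|[v w] s IHs]; first by rewrite big_nil.
by rewrite big_cons -IHs -cat1s -tens_addE.
Qed.

Lemma tensDl v v' w : tens (v + v') w = tens v w + tens v' w.
Proof. by rewrite [RHS]tens_addE; apply/tens_piP/TensDl. Qed.
Lemma tensDr v w w' : tens v (w + w') = tens v w + tens v w'.
Proof. by rewrite [RHS]tens_addE; apply/tens_piP/TensDr. Qed.
Lemma tens_bal v a w : tens (va v a) w = tens v (wa a w).
Proof. exact/tens_piP/TensBal. Qed.

Lemma tens_ind (P : tensor -> Prop) :
  P 0 -> (forall x y, P x -> P y -> P (x + y)) ->
  (forall v w, P (tens v w)) -> forall x, P x.
Proof.
move=> P0 PD Pt x; rewrite -[x]reprK tens_pi.
by elim/big_ind: _ => // p _; apply: Pt.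
Qed.

(* The homomorphism V (x)_S W -> G, v (x) w |-> f v w, for f balanced. *)
Definition tens_lift (G : zmodType) (f : V -> W -> G) (x : tensor) : G :=
  \sum_(p <- repr x) f p.1 p.2.

Section Lift.
Variables (G : zmodType) (f : V -> W -> G).
Hypothesis fDl : forall v v' w, f (v + v') w = f v w + f v' w.
Hypothesis fDr : forall v w w', f v (w + w') = f v w + f v w'.
Hypothesis f_bal : forall v a w, f (va v a) w = f v (wa a w).

Lemma tens_rel_lift s t : tens_rel s t ->
  \sum_(p <- s) f p.1 p.2 = \sum_(p <- t) f p.1 p.2.
Proof.
elim=> {s t} //.
- by move=> s t u _ -> _ ->.
- by move=> s s' t t' _ IHs _ IHt; rewrite !big_cat IHs IHt.
- by move=> s t; rewrite !big_cat /= addrC.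
- move=> w; rewrite big_seq1 big_nil.
  by apply: (addrI (f 0 w)); rewrite -fDl !addr0.
- by move=> v v' w; rewrite big_seq1 !big_cons big_nil addr0 fDl.
- by move=> v w w'; rewrite big_seq1 !big_cons big_nil addr0 fDr.
- by move=> v a w; rewrite !big_seq1 f_bal.
Qed.

Lemma tens_lift_pi s : tens_lift f (\pi_tensor s) = \sum_(p <- s) f p.1 p.2.
Proof. exact/tens_rel_lift/tens_repr. Qed.

Lemma tens_liftE v w : tens_lift f (tens v w) = f v w.
Proof. by rewrite tens_lift_pi big_seq1. Qed.

Lemma tens_liftD x y : tens_lift f (x + y) = tens_lift f x + tens_lift f y.
Proof.
rewrite -[x]reprK -[y]reprK [X in tens_lift f X]tens_addE.
by rewrite !tens_lift_pi big_cat.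
Qed.

Lemma tens_lift0 : tens_lift f 0 = 0.
Proof. by apply: (addrI (tens_lift f 0)); rewrite -tens_liftD !addr0. Qed.
End Lift.

Lemma tens_ext (G : zmodType) (f g : tensor -> G) :
  {morph f : x y / x + y} -> {morph g : x y / x + y} ->
  (forall v w, f (tens v w) = g (tens v w)) -> f =1 g.
Proof.
move=> fD gD fg; apply: tens_ind => [|x y fx fy|//].
  transitivity (0 : G); [|symmetry].
    by apply: (addrI (f 0)); rewrite -fD !addr0.
  by apply: (addrI (g 0)); rewrite -gD !addr0.
by rewrite fD gD fx fy.
Qed.
End Tensor.

Record bimodType (R S : pzRingType) := Bimodule {
  bimod_sort :> zmodType;
  lact : R -> bimod_sort -> bimod_sort;
  ract : bimod_sort -> S -> bimod_sort;
  lactA : forall a b x, lact a (lact b x) = lact (a * b) x;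
  lact1 : forall x, lact 1 x = x;
  lactDr : forall a x y, lact a (x + y) = lact a x + lact a y;
  lactDl : forall a b x, lact (a + b) x = lact a x + lact b x;
  ractA : forall x a b, ract (ract x a) b = ract x (a * b);
  ract1 : forall x, ract x 1 = x;
  ractDl : forall x y a, ract (x + y) a = ract x a + ract y a;
  ractDr : forall x a b, ract x (a + b) = ract x a + ract x b;
  lractA : forall a x b, ract (lact a x) b = lact a (ract x b)
}.

(* B (x)_S W, a left R-module, for an R-S-bimodule B and a left S-module W. *)
Section LeftTensor.
Variables (R S : pzRingType) (B : bimodType R S) (W : lmodType S).

Definition ltensor := tensor (@ract R S B) (fun (a : S) (w : W) => a *: w).
HB.instance Definition _ := GRing.Zmodule.on ltensor.

Definition ltens (x : B) (w : W) : ltensor := tens _ _ x w.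

Definition ltens_scale (a : R) : ltensor -> ltensor :=
  tens_lift (fun x w => ltens (lact a x) w).

Lemma ltens_scaleE a x w : ltens_scale a (ltens x w) = ltens (lact a x) w.
Proof.
apply: tens_liftE => [? ? ?|? ? ?|? ? ?]; rewrite /ltens.
- by rewrite lactDr tensDl.
- by rewrite tensDr.
- by rewrite -lractA tens_bal.
Qed.

Lemma ltens_scaleDr : right_distributive ltens_scale +%R.
Proof.
move=> a; apply: tens_liftD => [? ? ?|? ? ?|? ? ?]; rewrite /ltens.
- by rewrite lactDr tensDl.
- by rewrite tensDr.
- by rewrite -lractA tens_bal.
Qed.

Lemma ltens_scaleA a b v : ltens_scale a (ltens_scale b v) = ltens_scale (a * b) v.
Proof.
move: v; apply: (tens_ext (f := fun v => _) (g := fun v => _)) => [? ?|? ?|x w].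
- by rewrite !ltens_scaleDr.
- by rewrite !ltens_scaleDr.
- by rewrite -/(ltens x w) !ltens_scaleE lactA.
Qed.

Lemma ltens_scale1 : left_id 1 ltens_scale.
Proof.
apply: (tens_ext (f := fun v => _) (g := fun v => _)) => [? ?|//|x w].
- by rewrite !ltens_scaleDr.
- by rewrite -/(ltens x w) !ltens_scaleE lact1.
Qed.

Lemma ltens_scaleDl v : {morph ltens_scale^~ v : a b / a + b}.
Proof.
move=> a b /=; move: v.
apply: (tens_ext (f := fun v => _) (g := fun v => _)) => [? ?|? ?|x w].
- by rewrite !ltens_scaleDr.
- by rewrite !ltens_scaleDr addrACA.
- by rewrite -/(ltens x w) !ltens_scaleE lactDl /ltens tensDl.
Qed.

HB.instance Definition _ := GRing.Zmodule_isLmodule.Build R ltensor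
  ltens_scaleA ltens_scale1 ltens_scaleDr ltens_scaleDl.
End LeftTensor.

(* V (x)_R B, a right S-module, for a right R-module V and an R-S-bimodule B. *)
Section RightTensor.
Variables (R S : pzRingType) (V : rmodType R) (B : bimodType R S).

Definition rtensor := tensor (@rscale R V) (@lact R S B).
HB.instance Definition _ := GRing.Zmodule.on rtensor.

Definition rtens (v : V) (x : B) : rtensor := tens _ _ v x.

Definition rtens_scale (a : GRing.converse S) : rtensor -> rtensor :=
  tens_lift (fun v x => rtens v (@ract R S B x a)).

Lemma rtens_scaleE a v x : rtens_scale a (rtens v x) = rtens v (@ract R S B x a).
Proof.
apply: tens_liftE => [? ? ?|? ? ?|? ? ?]; rewrite /rtens.
- by rewrite tensDl.
- by rewrite ractDl tensDr.
- by rewrite lractA tens_bal.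
Qed.

Lemma rtens_scaleDr : right_distributive rtens_scale +%R.
Proof.
move=> a; apply: tens_liftD => [? ? ?|? ? ?|? ? ?]; rewrite /rtens.
- by rewrite tensDl.
- by rewrite ractDl tensDr.
- by rewrite lractA tens_bal.
Qed.

Lemma rtens_scaleA a b v : rtens_scale a (rtens_scale b v) = rtens_scale (a * b) v.
Proof.
move: v; apply: (tens_ext (f := fun v => _) (g := fun v => _)) => [? ?|? ?|v x].
- by rewrite !rtens_scaleDr.
- by rewrite !rtens_scaleDr.
- by rewrite -/(rtens v x) !rtens_scaleE ractA.
Qed.

Lemma rtens_scale1 : left_id 1 rtens_scale.
Proof.
apply: (tens_ext (f := fun v => _) (g := fun v => _)) => [? ?|//|v x].
- by rewrite !rtens_scaleDr.
- by rewrite -/(rtens v x) !rtens_scaleE ract1.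
Qed.

Lemma rtens_scaleDl v : {morph rtens_scale^~ v : a b / a + b}.
Proof.
move=> a b /=; move: v.
apply: (tens_ext (f := fun v => _) (g := fun v => _)) => [? ?|? ?|v x].
- by rewrite !rtens_scaleDr.
- by rewrite !rtens_scaleDr addrACA.
- by rewrite -/(rtens v x) !rtens_scaleE ractDr /rtens tensDr.
Qed.

HB.instance Definition _ := GRing.Zmodule_isLmodule.Build (GRing.converse S)
  rtensor rtens_scaleA rtens_scale1 rtens_scaleDr rtens_scaleDl.
End RightTensor.

Section DProd.
Variables (I : Type) (P : I -> zmodType).

Definition dprod := forall i, P i.
HB.instance Definition _ := Choice.on dprod.
Implicit Types x y : dprod.

Lemma dprodP x y : (forall i, x i = y i) -> x = y.
Proof. exact: functional_extensionality_dep. Qed.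

Let add x y : dprod := fun i => x i + y i.
Let opp x : dprod := fun i => - x i.
Let zero : dprod := fun=> 0.
Let addA : associative add.
Proof. by move=> x y z; apply: dprodP => i; apply: addrA. Qed.
Let addC : commutative add.
Proof. by move=> x y; apply: dprodP => i; apply: addrC. Qed.
Let add0 : left_id zero add.
Proof. by move=> x; apply: dprodP => i; apply: add0r. Qed.
Let addN : left_inverse zero opp add.
Proof. by move=> x; apply: dprodP => i; apply: addNr. Qed.
HB.instance Definition _ := GRing.isZmodule.Build dprod addA addC add0 addN.

Lemma dprodDE x y i : (x + y) i = x i + y i. Proof. by []. Qed.
Lemma dprodNE x i : (- x) i = - x i. Proof. by []. Qed.
Lemma dprod0E i : (0 : dprod) i = 0. Proof. by []. Qed.
End DProd.

Section ProdRing.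
Variables (I : Type) (A : I -> pzRingType).

Definition prod_ring := dprod A.
HB.instance Definition _ := GRing.Zmodule.on prod_ring.
Implicit Types x y : prod_ring.

Let mul x y : prod_ring := fun i => x i * y i.
Let one : prod_ring := fun=> 1.
Let mulA : associative mul.
Proof. by move=> x y z; apply: dprodP => i; apply: mulrA. Qed.
Let mul1 : left_id one mul.
Proof. by move=> x; apply: dprodP => i; apply: mul1r. Qed.
Let mulr1 : right_id one mul.
Proof. by move=> x; apply: dprodP => i; apply: mulr1. Qed.
Let mulDl : left_distributive mul +%R.
Proof. by move=> x y z; apply: dprodP => i; apply: mulrDl. Qed.
Let mulDr : right_distributive mul +%R.
Proof. by move=> x y z; apply: dprodP => i; apply: mulrDr. Qed.
HB.instance Definition _ :=
  GRing.Zmodule_isPzRing.Build prod_ring mulA mul1 mulr1 mulDl mulDr.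
End ProdRing.

(* The A_0-A_0-bimodule formed by all the M i j, where A_0 is the product of
   the A i: it is their direct sum when I is finite. *)
Section SumBimodule.
Variables (I : finType) (A : I -> pzRingType).
Variable M : forall i j, bimodType (A i) (A j).

Let carrier : zmodType := dprod (fun ij : I * I => M ij.1 ij.2).
Let l (a : prod_ring A) (x : carrier) : carrier := fun ij => lact (a ij.1) (x ij).
Let r (x : carrier) (a : prod_ring A) : carrier := fun ij => ract (x ij) (a ij.2).

Definition sum_bimod : bimodType (prod_ring A) (prod_ring A).
Proof.
refine (@Bimodule _ _ carrier l r _ _ _ _ _ _ _ _ _);
  move=> *; apply: dprodP => ij.
- exact: lactA.
- exact: lact1.
- exact: lactDr.
- exact: lactDl.
- exact: ractA.
- exact: ract1.
- exact: ractDl.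
- exact: ractDr.
- exact: lractA.
Defined.
End SumBimodule.

Section DSum.
Variables (R : pzRingType) (P : nat -> lmodType R).

Definition finitely_supported (f : dprod P) : bool :=
  `[< exists N, forall n, (N <= n)%N -> f n = 0 >].

Record dsum := Dsum { dsum_val : dprod P; _ : finitely_supported dsum_val }.
Definition dsum_fun (f : dsum) : forall n, P n := dsum_val f.
Coercion dsum_fun : dsum >-> Funclass.
HB.instance Definition _ := [isSub for dsum_val].
HB.instance Definition _ := [Choice of dsum by <:].

Lemma finitely_supported_closed : zmod_closed finitely_supported.
Proof.
split=> [|f g]; first by apply/asboolP; exists 0%N.
move=> /asboolP[N fN] /asboolP[N' gN']; apply/asboolP; exists (maxn N N').
move=> n; rewrite geq_max => /andP[Nn N'n].
by rewrite dprodDE dprodNE fN // gN' // subr0.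
Qed.
HB.instance Definition _ :=
  GRing.isZmodClosed.Build _ finitely_supported finitely_supported_closed.
HB.instance Definition _ := [SubChoice_isSubZmodule of dsum by <:].

Lemma dsumP (f g : dsum) : (forall n, f n = g n) -> f = g.
Proof. by move=> fg; apply/val_inj/dprodP. Qed.

Lemma dsumDE (f g : dsum) n : (f + g) n = f n + g n. Proof. by []. Qed.
Lemma dsum0E n : (0 : dsum) n = 0. Proof. by []. Qed.

Lemma dsum_bound (f : dsum) : {N | forall n, (N <= n)%N -> f n = 0}.
Proof. by apply: cid; case: f => f /= /asboolP. Qed.

Lemma dscale_subproof (a : R) (f : dsum) :
  finitely_supported (fun n => a *: f n).
Proof.
have [N fN] := dsum_bound f.
by apply/asboolP; exists N => n Nn; rewrite fN // scaler0.
Qed.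
Definition dscale a f : dsum := Dsum (dscale_subproof a f).

Let dscaleA a b f : dscale a (dscale b f) = dscale (a * b) f.
Proof. by apply: dsumP => n; apply: scalerA. Qed.
Let dscale1 : left_id 1 dscale.
Proof. by move=> f; apply: dsumP => n; apply: scale1r. Qed.
Let dscaleDr : right_distributive dscale +%R.
Proof. by move=> a f g; apply: dsumP => n; apply: scalerDr. Qed.
Let dscaleDl f : {morph dscale^~ f : a b / a + b}.
Proof. by move=> a b; apply: dsumP => n; apply: scalerDl. Qed.
HB.instance Definition _ :=
  GRing.Zmodule_isLmodule.Build R dsum dscaleA dscale1 dscaleDr dscaleDl.

Lemma dsumZE a (f : dsum) n : (a *: f) n = a *: f n. Proof. by []. Qed.

Fact homog_subproof n (x : P n) : finitely_supported (fun m =>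
  if eqVneq n m is EqNotNeq e then ecast m (P m) e x else 0).
Proof.
apply/asboolP; exists n.+1 => m; case: eqVneq => // e; subst m.
by rewrite ltnn.
Qed.

Definition homog n (x : P n) : dsum := Dsum (homog_subproof x).

Lemma homogE n (x : P n) : homog x n = x.
Proof.
rewrite /homog /=; case: eqVneq => [e|/eqP //].
by rewrite (eq_axiomK e).
Qed.
Lemma homog_neq n m (x : P n) : n != m -> homog x m = 0.
Proof. by rewrite /homog /=; case: eqVneq. Qed.
End DSum.

Section TensorAlgebra.
Variables (R : pzRingType) (M : bimodType R R).

(* M^{(x) n}, with M^{(x) 0} = R and M^{(x) n.+1} = M (x)_R M^{(x) n}; in
   particular M^{(x) 1} is M (x)_R R, i.e., M.  The right action of R is the
   multiplication by elements of degree 0 defined below. *)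
Fixpoint tpow (n : nat) : lmodType R :=
  if n is n'.+1 then ltensor M (tpow n') else R^o.

Definition tensor_alg := dsum tpow.
HB.instance Definition _ := GRing.Lmodule.on tensor_alg.
Implicit Types f g h : tensor_alg.

Definition tshift_fun (x : M) f : dprod tpow :=
  fun n => match n return tpow n with 0 => 0 | n'.+1 => ltens x (f n') end.

Lemma ltensx0 (W : lmodType R) (x : M) : ltens x (0 : W) = 0.
Proof. by apply: (addrI (ltens x (0 : W))); rewrite -tensDr !addr0. Qed.

Lemma tshift_subproof x f : finitely_supported (tshift_fun x f).
Proof.
have [N fN] := dsum_bound f; apply/asboolP; exists N.+1 => -[|n] //= Nn.
by rewrite fN // ltensx0.
Qed.

(* x (x) f, for x in M. *)
Definition tshift x f : tensor_alg := Dsum (tshift_subproof x f).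

Lemma tshiftDl x y f : tshift (x + y) f = tshift x f + tshift y f.
Proof.
by apply: dsumP => -[|n]; rewrite dsumDE /=; [rewrite addr0|apply: tensDl].
Qed.
Lemma tshiftDr x f g : tshift x (f + g) = tshift x f + tshift x g.
Proof.
by apply: dsumP => -[|n]; rewrite dsumDE /=; [rewrite addr0|apply: tensDr].
Qed.
Lemma tshift_bal x a f : tshift (ract x a) f = tshift x (a *: f).
Proof. by apply: dsumP => -[|n] //=; apply: tens_bal. Qed.
Lemma tshiftZ a x f : a *: tshift x f = tshift (lact a x) f.
Proof.
apply: dsumP => -[|n]; rewrite dsumZE /=; first by rewrite scaler0.
exact: ltens_scaleE.
Qed.

(* The product of t, of degree n, and g: it is determined by
   a g = a *: g in degree 0, and (x (x) t) g = x (x) (t g). *)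
Fixpoint tact (n : nat) : tpow n -> tensor_alg -> tensor_alg :=
  match n return tpow n -> tensor_alg -> tensor_alg with
  | 0 => fun a g => (a : R) *: g
  | n'.+1 => fun t g => tens_lift (fun x t' => tshift x (tact t' g)) t
  end.

Lemma tact_lin n :
  [/\ forall g (t u : tpow n), tact (t + u) g = tact t g + tact u g,
      forall a (t : tpow n) g, tact (a *: t) g = a *: tact t g &
      forall (t : tpow n) g h, tact t (g + h) = tact t g + tact t h].
Proof.
elim: n => [|n [IHDl IHZ IHDr]].
  split=> [g t u|a t g|t g h]; first exact: scalerDl.
    by rewrite /= scalerA.
  exact: scalerDr.
have bDl g (x y : M) (t : tpow n) :
    tshift (x + y) (tact t g) = tshift x (tact t g) + tshift y (tact t g).
  exact: tshiftDl.
have bDr g (x : M) (t u : tpow n) :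
    tshift x (tact (t + u) g) = tshift x (tact t g) + tshift x (tact u g).
  by rewrite IHDl tshiftDr.
have bB g (x : M) a (t : tpow n) :
    tshift (ract x a) (tact t g) = tshift x (tact (a *: t) g).
  by rewrite IHZ tshift_bal.
have liftD g := tens_liftD (bDl g) (bDr g) (bB g).
have liftE g := tens_liftE (bDl g) (bDr g) (bB g).
split=> [g t u|a t g|t g h]; first exact: liftD.
- move: t; apply: (tens_ext (f := fun t => @tact n.+1 (a *: (t : tpow n.+1)) g)
    (g := fun t => a *: @tact n.+1 t g)) => [t u|t u|x t].
  + by rewrite scalerDr [LHS]liftD.
  + by rewrite [tact _ _]liftD scalerDr.
  + rewrite [X in tact X _]ltens_scaleE [LHS]liftE /= liftE.
    by rewrite tshiftZ.
- move: t; apply: (tens_ext (f := fun t => @tact n.+1 t (g + h))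
    (g := fun t => @tact n.+1 t g + @tact n.+1 t h)) => [t u|t u|x t].
  + exact: liftD.
  + by rewrite ![tact (_ + _) _]liftD addrACA.
  + by rewrite /= !liftE IHDr tshiftDr.
Qed.

Lemma tactDl n g (t u : tpow n) : tact (t + u) g = tact t g + tact u g.
Proof. by case: (tact_lin n). Qed.
Lemma tactZ n a (t : tpow n) g : tact (a *: t) g = a *: tact t g.
Proof. by case: (tact_lin n). Qed.
Lemma tactDr n (t : tpow n) g h : tact t (g + h) = tact t g + tact t h.
Proof. by case: (tact_lin n). Qed.

Lemma tact0l n g : tact (0 : tpow n) g = 0.
Proof. by apply: (addrI (tact (0 : tpow n) g)); rewrite -tactDl !addr0. Qed.
Lemma tact0r n (t : tpow n) : tact t 0 = 0.
Proof. by apply: (addrI (tact t 0)); rewrite -tactDr !addr0. Qed.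

Lemma tactS n x (t : tpow n) g :
  @tact n.+1 (ltens x t) g = tshift x (tact t g).
Proof.
apply: (tens_liftE (f := fun x t' => tshift x (tact t' g))) => *.
- exact: tshiftDl.
- by rewrite tactDl tshiftDr.
- by rewrite tactZ tshift_bal.
Qed.

Definition tmul f g : tensor_alg := \sum_(n < sval (dsum_bound f)) tact (f n) g.

Definition tone : tensor_alg := homog (P := tpow) (n := 0) (1 : R).

Lemma tmul_widen N f g : (forall n, (N <= n)%N -> f n = 0) ->
  tmul f g = \sum_(n < N) tact (f n) g.
Proof.
have aux N1 N2 : (N1 <= N2)%N -> (forall n, (N1 <= n)%N -> f n = 0) ->
    \sum_(n < N1) tact (f n) g = \sum_(n < N2) tact (f n) g.
  move=> le12 f0; rewrite (big_ord_widen _ (fun n => tact (f n) g) le12).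
  rewrite big_mkcond; apply: eq_bigr => n _; case: ifPn => //.
  by rewrite -leqNgt => /f0 ->; rewrite tact0l.
move=> fN; rewrite /tmul; case: dsum_bound => N' fN' /=.
by case/orP: (leq_total N N') => le; [rewrite -(aux _ _ le)|rewrite (aux _ _ le)].
Qed.

Lemma tmulDl : left_distributive tmul +%R.
Proof.
move=> f g h; have [N fN] := dsum_bound f; have [N' gN] := dsum_bound g.
have le n : (maxn N N' <= n)%N -> (N <= n)%N /\ (N' <= n)%N.
  by rewrite geq_max => /andP.
rewrite (@tmul_widen (maxn N N') f); last by move=> n /le[/fN].
rewrite (@tmul_widen (maxn N N') g); last by move=> n /le[_ /gN].
rewrite (@tmul_widen (maxn N N') (f + g)); last first.
  by move=> n /le[/fN fn /gN gn]; rewrite dsumDE fn gn addr0.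
by rewrite -big_split; apply: eq_bigr => n _; apply: tactDl.
Qed.

Lemma tmulDr : right_distributive tmul +%R.
Proof.
by move=> f g h; rewrite /tmul -big_split; apply: eq_bigr => n _; apply: tactDr.
Qed.

Lemma tmul0r f : tmul f 0 = 0.
Proof. by rewrite /tmul big1 // => n _; apply: tact0r. Qed.

Lemma tmul0l g : tmul 0 g = 0.
Proof. by rewrite (@tmul_widen 0) ?big_ord0. Qed.

Lemma tmulZ a f g : tmul (a *: f) g = a *: tmul f g.
Proof.
have [N fN] := dsum_bound f; rewrite !(@tmul_widen N) //; last first.
  by move=> n /fN fn; rewrite dsumZE fn scaler0.
by rewrite scaler_sumr; apply: eq_bigr => n _; rewrite dsumZE tactZ.
Qed.

Lemma tshift_sum x (J : Type) (r : seq J) (p : pred J) (F : J -> tensor_alg) :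
  tshift x (\sum_(j <- r | p j) F j) = \sum_(j <- r | p j) tshift x (F j).
Proof.
elim/big_rec2: _ => [|j y z _ <-]; last by rewrite tshiftDr.
by apply: (addrI (tshift x 0)); rewrite -tshiftDr !addr0.
Qed.

Lemma tmul_tshift x f g : tmul (tshift x f) g = tshift x (tmul f g).
Proof.
have [N fN] := dsum_bound f.
rewrite (@tmul_widen N.+1); last by move=> [|n] //= Nn; rewrite fN // ltensx0.
rewrite (tmul_widen _ fN) big_ord_recl [X in X + _]tact0l add0r.
by rewrite tshift_sum; apply: eq_bigr => n _; rewrite -tactS.
Qed.

Lemma tmul_tact n (t : tpow n) f g : tmul (tact t f) g = tact t (tmul f g).
Proof.
elim: n t f => [|n IHn] t f; first exact: tmulZ.
move: t; apply: (tens_ext (f := fun t => tmul (@tact n.+1 t f) g)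
  (g := fun t => @tact n.+1 t (tmul f g))) => [t u|t u|x t].
- by rewrite (tactDl f (t : tpow n.+1)) tmulDl.
- exact: (tactDl _ (t : tpow n.+1)).
- by rewrite -/(ltens x t) !tactS tmul_tshift IHn.
Qed.

Lemma tmulA : associative tmul.
Proof.
move=> f g h; have [N fN] := dsum_bound f; rewrite !(tmul_widen _ fN).
elim: (index_enum _) => [|n r IHr]; first by rewrite !big_nil tmul0l.
by rewrite !big_cons tmulDl tmul_tact IHr.
Qed.

Lemma tmul1 : left_id tone tmul.
Proof.
move=> f; rewrite (@tmul_widen 1); last by move=> [|n] // _; apply: homog_neq.
by rewrite big_ord1 homogE /= scale1r.
Qed.

Lemma tact_one n (t : tpow n) : tact t tone = homog t.
Proof.
elim: n t => [|n IHn] t.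
  apply: dsumP => m; rewrite -[tact t tone]/((t : R) *: tone) dsumZE; case: (eqVneq 0 m) => [<-|m0].
    by rewrite !homogE; apply: mulr1.
  by rewrite !homog_neq // scaler0.
have homogD (u v : tpow n.+1) : homog (u + v) = homog u + homog v.
  apply: dsumP => m; rewrite dsumDE; case: (eqVneq n.+1 m) => [<-|mn].
    by rewrite !homogE.
  by rewrite !homog_neq // addr0.
move: t; apply: (tens_ext (f := fun t => @tact n.+1 t tone)
  (g := fun t => homog (t : tpow n.+1))) => [t u|//|x t].
- exact: (tactDl _ (t : tpow n.+1)).
- rewrite -/(ltens x t) tactS IHn; apply: dsumP => -[|m].
    by rewrite [RHS]homog_neq.
  change (ltens x (homog t m) = homog (P := tpow) (n := n.+1) (ltens x t) m.+1).
  case: (eqVneq n m) => [<-|nm]; first by rewrite !homogE.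
  by rewrite !homog_neq ?eqSS // ltensx0.
Qed.

Lemma tmulr1 : right_id tone tmul.
Proof.
move=> f; apply: dsumP => m; have [N fN] := dsum_bound f.
rewrite (tmul_widen _ fN).
under eq_bigr do rewrite tact_one.
have -> (r : seq 'I_N) (F : 'I_N -> tensor_alg) :
    (\sum_(n <- r) F n) m = \sum_(n <- r) F n m.
  by elim: r => [|n r IHr]; rewrite ?big_nil // !big_cons dsumDE IHr.
case: (ltnP m N) => [mN|Nm]; last first.
  rewrite fN // big1 // => n _; apply: homog_neq.
  by rewrite ltn_eqF // (leq_trans (ltn_ord n)).
rewrite (bigD1 (Ordinal mN)) // big1.
  by rewrite [LHS]addr0; apply: homogE.
by move=> n nm; apply: homog_neq.
Qed.

HB.instance Definition _ := GRing.Zmodule_isPzRing.Build tensor_alg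
  tmulA tmul1 tmulr1 tmulDl tmulDr.
End TensorAlgebra.

Record category := Category {
  obj :> Type;
  hom : obj -> obj -> Type;
  idm : forall x, hom x x;
  comp : forall x y z, hom y z -> hom x y -> hom x z;
  comp1m : forall x y (f : hom x y), comp (idm y) f = f;
  compm1 : forall x y (f : hom x y), comp f (idm x) = f;
  compA : forall x y z t (f : hom z t) (g : hom y z) (h : hom x y),
    comp f (comp g h) = comp (comp f g) h
}.
Arguments idm {c} x.

Record functor (C D : category) := Functor {
  fobj :> C -> D;
  fmap : forall x y, hom x y -> hom (fobj x) (fobj y);
  fmap_id : forall x, fmap (idm x) = idm (fobj x);
  fmap_comp : forall x y z (f : hom y z) (g : hom x y),
    fmap (comp f g) = comp (fmap f) (fmap g)
}.

Definition functor_id (C : category) : functor C C.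
Proof. by refine (@Functor C C id (fun _ _ f => f) _ _). Defined.

Definition functor_comp (C D E : category) (G : functor D E) (F : functor C D) :
  functor C E.
Proof.
refine (@Functor C E (fun x => G (F x)) (fun _ _ f => fmap G (fmap F f)) _ _).
- by move=> x; rewrite !fmap_id.
- by move=> x y z f g; rewrite !fmap_comp.
Defined.

Record nat_iso (C D : category) (F G : functor C D) := NatIso {
  iso_hom : forall x, hom (F x) (G x);
  iso_inv : forall x, hom (G x) (F x);
  iso_homK : forall x, comp (iso_inv x) (iso_hom x) = idm (F x);
  iso_invK : forall x, comp (iso_hom x) (iso_inv x) = idm (G x);
  iso_nat : forall x y (f : hom x y),
    comp (iso_hom y) (fmap F f) = comp (fmap G f) (iso_hom x)
}.

Definition equivalent (C D : category) : Prop :=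
  exists (F : functor C D) (G : functor D C),
    inhabited (nat_iso (functor_comp G F) (functor_id C)) /\
    inhabited (nat_iso (functor_comp F G) (functor_id D)).

Definition full_subcategory (C : category) (P : C -> Prop) : category.
Proof.
refine (@Category {x : C | P x} (fun x y => hom (sval x) (sval y))
  (fun x => idm (sval x)) (fun x y z f g => comp f g) _ _ _).
- by move=> *; apply: comp1m.
- by move=> *; apply: compm1.
- by move=> *; apply: compA.
Defined.

Lemma linear_ext (R : pzRingType) (U V : lmodType R) (f g : {linear U -> V}) :
  f =1 g -> f = g.
Proof.
case: f g => [f [[fD] [fZ]]] [g [[gD] [gZ]]] fg.
have {}fg : f = g by apply: funext.
by subst g; rewrite (Prop_irrelevance fD gD) (Prop_irrelevance fZ gZ).
Qed.

Definition linear_id (R : pzRingType) (U : lmodType R) : {linear U -> U} := idfun.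

Definition linear_comp (R : pzRingType) (U V W : lmodType R)
  (g : {linear V -> W}) (f : {linear U -> V}) : {linear U -> W} := g \o f.

Definition Mod (R : pzRingType) : category.
Proof.
refine (@Category (rmodType R) (fun U V => {linear U -> V})
  (@linear_id (GRing.converse R)) (@linear_comp (GRing.converse R)) _ _ _).
- by move=> *; apply: linear_ext.
- by move=> *; apply: linear_ext.
- by move=> *; apply: linear_ext.
Defined.

Definition fin_gen (R : pzRingType) (V : rmodType R) : Prop :=
  exists n (g : 'I_n -> V), forall v, exists c : 'I_n -> R,
    v = \sum_i rscale (g i) (c i).

Definition mod_fg (R : pzRingType) : category :=
  @full_subcategory (Mod R) (@fin_gen R).

(* The valuation of the valued quiver is determined by the bimodules and does
   not enter the definition of representations: only its edges do. *)
Record premodulation (k : fieldType) := Premodulation {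
  pm_vertex : finType;
  pm_alg : pm_vertex -> falgType k;
  pm_bimod : forall i j, bimodType (pm_alg i) (pm_alg j)
}.

Section Representations.
Variables (k : fieldType) (M : premodulation k).
Let I := pm_vertex M.
Let A : I -> falgType k := @pm_alg k M.

Definition edge (i j : I) : Prop := exists x : pm_bimod i j, x <> 0.

Record representation := Representation {
  rep_space :> forall i, rmodType (A i);
  rep_map : forall i j, edge i j ->
    {linear rtensor (rep_space i) (pm_bimod i j) -> rep_space j}
}.

(* alpha (x) id *)
Definition rtensor_map (R S : pzRingType) (U V : rmodType R) (B : bimodType R S)
    (alpha : {linear U -> V}) : rtensor U B -> rtensor V B :=
  tens_lift (fun u x => rtens (alpha u) x).

Record rep_hom (V U : representation) := RepHom {
  rep_homs :> forall i, {linear V i -> U i};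
  rep_hom_comm : forall i j (e : edge i j) (x : rtensor (V i) (pm_bimod i j)),
    rep_homs j (rep_map V e x) = rep_map U e (rtensor_map (rep_homs i) x)
}.

Lemma rep_hom_ext (V U : representation) (f g : rep_hom V U) :
  (forall i, f i =1 g i) -> f = g.
Proof.
case: f g => [f fc] [g gc] /= fg.
have {}fg : f = g.
  by apply: functional_extensionality_dep => i; exact: linear_ext (fg i).
by subst g; congr RepHom; apply: Prop_irrelevance.
Qed.

Lemma rtensor_mapE (R S : pzRingType) (U V : rmodType R) (B : bimodType R S)
  (alpha : {linear U -> V}) u (x : B) :
  rtensor_map alpha (rtens u x) = rtens (alpha u) x.
Proof.
apply: tens_liftE => [u1 u2 y|u1 y1 y2|u1 a y]; rewrite /rtens.
- by rewrite linearD tensDl.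
- by rewrite tensDr.
- by rewrite [alpha _]linearZ; apply: (tens_bal (@rscale R V)).
Qed.

Lemma rtensor_mapD (R S : pzRingType) (U V : rmodType R) (B : bimodType R S)
  (alpha : {linear U -> V}) :
  {morph rtensor_map (B := B) alpha : x y / x + y}.
Proof.
apply: tens_liftD => [u1 u2 y|u1 y1 y2|u1 a y]; rewrite /rtens.
- by rewrite linearD tensDl.
- by rewrite tensDr.
- by rewrite [alpha _]linearZ; apply: (tens_bal (@rscale R V)).
Qed.

Lemma rtensor_map_id (R S : pzRingType) (U : rmodType R) (B : bimodType R S) :
  rtensor_map (B := B) (linear_id U) =1 id.
Proof.
apply: (tens_ext (f := rtensor_map (B := B) (linear_id U)) (g := id))
  => [x y|//|u x]; first exact: rtensor_mapD.
exact: rtensor_mapE.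
Qed.

Lemma rtensor_map_comp (R S : pzRingType) (U V W : rmodType R)
  (B : bimodType R S) (g : {linear V -> W}) (f : {linear U -> V}) :
  rtensor_map (B := B) (linear_comp g f) =1 rtensor_map g \o rtensor_map f.
Proof.
apply: (tens_ext (f := rtensor_map (B := B) (linear_comp g f))
  (g := rtensor_map g \o rtensor_map f)) => [x y|x y|u x].
- exact: rtensor_mapD.
- by rewrite /= !rtensor_mapD.
- rewrite -[tens _ _ _ _]/(rtens u x) [LHS]rtensor_mapE /=.
  by rewrite !rtensor_mapE.
Qed.

Definition rep_id (V : representation) : rep_hom V V.
Proof.
refine (@RepHom V V (fun i => linear_id (V i)) _).
by move=> i j e x; rewrite rtensor_map_id.
Defined.

Definition rep_comp (V U W : representation) (g : rep_hom U W) (f : rep_hom V U) :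
  rep_hom V W.
Proof.
refine (@RepHom V W (fun i => linear_comp (g i) (f i)) _).
by move=> i j e x; rewrite rtensor_map_comp /= !rep_hom_comm.
Defined.

Definition Rep : category.
Proof.
refine (@Category representation rep_hom rep_id rep_comp _ _ _).
- by move=> *; apply: rep_hom_ext.
- by move=> *; apply: rep_hom_ext.
- by move=> *; apply: rep_hom_ext.
Defined.

Definition rep_fin_gen (V : representation) : Prop := forall i, fin_gen (V i).

Definition rep_fg : category := @full_subcategory Rep rep_fin_gen.
End Representations.

(* A (x)_k B is the free A-B-bimodule (the free A (x)_k B^op-module) of rank 1. *)
Section AlgBimodule.
Variables (k : fieldType) (A B : algType k).

Definition alg_tensor :=
  tensor (fun (x : A) (c : k) => c *: x) (fun (c : k) (y : B) => c *: y).
HB.instance Definition _ := GRing.Zmodule.on alg_tensor.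

Definition alg_tens (x : A) (y : B) : alg_tensor := tens _ _ x y.
Definition alg_lact (a : A) : alg_tensor -> alg_tensor :=
  tens_lift (fun x y => alg_tens (a * x) y).
Definition alg_ract (t : alg_tensor) (b : B) : alg_tensor :=
  tens_lift (fun x y => alg_tens x (y * b)) t.

Let lDl a (x x' : A) (y : B) :
  alg_tens (a * (x + x')) y = alg_tens (a * x) y + alg_tens (a * x') y.
Proof. by rewrite mulrDr; apply: tensDl. Qed.
Let lDr a (x : A) (y y' : B) :
  alg_tens (a * x) (y + y') = alg_tens (a * x) y + alg_tens (a * x) y'.
Proof. exact: tensDr. Qed.
Let lbal a (x : A) (c : k) (y : B) :
  alg_tens (a * (c *: x)) y = alg_tens (a * x) (c *: y).
Proof. by rewrite -scalerAr; apply: tens_bal. Qed.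
Let rDl b (x x' : A) (y : B) :
  alg_tens (x + x') (y * b) = alg_tens x (y * b) + alg_tens x' (y * b).
Proof. exact: tensDl. Qed.
Let rDr b (x : A) (y y' : B) :
  alg_tens x ((y + y') * b) = alg_tens x (y * b) + alg_tens x (y' * b).
Proof. by rewrite mulrDl; apply: tensDr. Qed.
Let rbal b (x : A) (c : k) (y : B) :
  alg_tens (c *: x) (y * b) = alg_tens x (c *: y * b).
Proof. by rewrite -scalerAl; apply: tens_bal. Qed.

Lemma alg_lactE a x y : alg_lact a (alg_tens x y) = alg_tens (a * x) y.
Proof. exact: tens_liftE (lDl a) (lDr a) (lbal a) x y. Qed.
Lemma alg_ractE b x y : alg_ract (alg_tens x y) b = alg_tens x (y * b).
Proof. exact: tens_liftE (rDl b) (rDr b) (rbal b) x y. Qed.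
Lemma alg_lactD a t u : alg_lact a (t + u) = alg_lact a t + alg_lact a u.
Proof. exact: tens_liftD (lDl a) (lDr a) (lbal a) t u. Qed.
Lemma alg_ractD b t u : alg_ract (t + u) b = alg_ract t b + alg_ract u b.
Proof. exact: tens_liftD (rDl b) (rDr b) (rbal b) t u. Qed.

Definition alg_bimod : bimodType A B.
Proof.
refine (@Bimodule A B alg_tensor alg_lact alg_ract _ _ _ _ _ _ _ _ _).
- move=> a b; apply: tens_ext => [t u|t u|x y].
  + by rewrite !alg_lactD.
  + by rewrite !alg_lactD.
  + by rewrite -/(alg_tens x y) !alg_lactE mulrA.
- apply: tens_ext => [t u|t u|x y] //.
  + by rewrite !alg_lactD.
  + by rewrite -/(alg_tens x y) !alg_lactE mul1r.
- exact: alg_lactD.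
- move=> a b; apply: tens_ext => [t u|t u|x y].
  + by rewrite !alg_lactD.
  + by rewrite !alg_lactD addrACA.
  + by rewrite -/(alg_tens x y) !alg_lactE mulrDl; apply: tensDl.
- move=> t a b; move: t; apply: (tens_ext
    (f := fun t => alg_ract (alg_ract t a) b)
    (g := fun t => alg_ract t (a * b))) => [t u|t u|x y].
  + by rewrite !alg_ractD.
  + by rewrite !alg_ractD.
  + by rewrite -/(alg_tens x y) !alg_ractE mulrA.
- apply: (tens_ext (f := fun t => alg_ract t 1) (g := fun t => t))
    => [t u|t u|x y] //.
  + by rewrite !alg_ractD.
  + by rewrite -/(alg_tens x y) !alg_ractE mulr1.
- by move=> t u a; apply: alg_ractD.
- move=> t a b; move: t; apply: (tens_ext (f := fun t => alg_ract t (a + b))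
    (g := fun t => alg_ract t a + alg_ract t b)) => [t u|t u|x y].
  + by rewrite !alg_ractD.
  + by rewrite !alg_ractD addrACA.
  + by rewrite -/(alg_tens x y) !alg_ractE mulrDr; apply: tensDr.
- move=> a t b; move: t; apply: (tens_ext
    (f := fun t => alg_ract (alg_lact a t) b)
    (g := fun t => alg_lact a (alg_ract t b))) => [t u|t u|x y].
  + by rewrite alg_lactD !alg_ractD.
  + by rewrite alg_ractD !alg_lactD.
  + by rewrite -/(alg_tens x y) alg_lactE !alg_ractE alg_lactE.
Defined.

Definition free_bimod (X : finType) : bimodType A B.
Proof.
refine (@Bimodule A B {ffun X -> alg_bimod}
  (fun a f => [ffun x => lact a (f x)]) (fun f b => [ffun x => ract (f x) b])
  _ _ _ _ _ _ _ _ _); move=> *; apply/ffunP => x; rewrite !ffunE.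
- exact: lactA.
- exact: lact1.
- exact: lactDr.
- exact: lactDl.
- exact: ractA.
- exact: ract1.
- exact: ractDl.
- exact: ractDr.
- exact: lractA.
Defined.
End AlgBimodule.

Record quiver := Quiver {
  vertex : finType;
  arrow : finType;
  source : arrow -> vertex;
  target : arrow -> vertex
}.

Section GeneralizedPathAlgebra.
Variables (k : fieldType) (Q : quiver) (A : vertex Q -> falgType k).

Definition arrows (i j : vertex Q) : finType :=
  {a : arrow Q | (source a == i) && (target a == j)}.

Definition gpa_premodulation : premodulation k :=
  @Premodulation k (vertex Q) A (fun i j => free_bimod (A i) (A j) (arrows i j)).

Definition gen_path_alg : pzRingType :=
  tensor_alg (sum_bimod (pm_bimod (p := gpa_premodulation))).
End GeneralizedPathAlgebra.

Definition has_arrow (Q : quiver) : rel (vertex Q) :=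
  fun i j => [exists a, (source a == i) && (target a == j)].

(* A loop is a cycle of length 1.  On an oriented cycle, representations and
   modules have different notions of finite generation: if Q is one loop and
   A = k, then gen_path_alg is k[x], which is a finitely generated module over
   itself but is infinite-dimensional over k. *)
Definition acyclic (Q : quiver) : Prop :=
  forall c : seq (vertex Q), cycle (@has_arrow Q) c -> c = [::].

(* Main.v *)
Require Import Defs.
From mathcomp Require Import all_boot all_algebra falgebra.
From HB Require Import structures.
From mathcomp Require Import boolp.

(* A right module over the tensor algebra T(A_0, M) is the same thing as a right
   A_0-module W together with an A_0-linear map from W (x) M to W: its action
   extends uniquely to the powers of M, since T(A_0, M) is generated by A_0 and
   M.  The idempotents of A_0 = prod_i A_i split W into the components W e_i,
   and the action of M into the maps W e_i (x) iMj -> W e_j: this is a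
   representation.  Conversely, the product of the spaces of a representation
   is such a W.
     Generators of all the V_i together generate prod_i V_i.  Conversely, if W
   is generated by g_1, ..., g_n, then W e_j is generated over A_j by the g_l e_j
   and by the images of the W e_i (x) iMj; as iMj is a finitely generated right
   A_j-module and Q is acyclic, W e_j is finitely generated by induction on
   j. *)

Set Implicit Arguments.
Unset Strict Implicit.
Unset Printing Implicit Defensive.

Import GRing.Theory.
Local Open Scope ring_scope.

(** * Additive maps and right modules *)

Lemma additive0 (U V : zmodType) (f : U -> V) :
  {morph f : x y / x + y} -> f 0 = 0.
Proof. by move=> fD; apply: (addrI (f 0)); rewrite -fD !addr0. Qed.

Lemma additive_sum (U V : zmodType) (f : U -> V) (J : Type) (r : seq J)
    (P : pred J) (F : J -> U) : {morph f : x y / x + y} ->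
  f (\sum_(j <- r | P j) F j) = \sum_(j <- r | P j) f (F j).
Proof. by move=> fD; apply: (big_morph f fD (additive0 fD)). Qed.

Section RightModules.
Variables (R : pzRingType).

Section Theory.
Variable V : rmodType R.
Implicit Types (v w : V) (a b : R).

Lemma rscaleA v a b : rscale (rscale v a) b = rscale v (a * b).
Proof. by rewrite /rscale scalerA. Qed.
Lemma rscale1 v : rscale v 1 = v.
Proof. exact: scale1r. Qed.
Lemma rscaleDl v w a : rscale (v + w) a = rscale v a + rscale w a.
Proof. exact: scalerDr. Qed.
Lemma rscaleDr v a b : rscale v (a + b) = rscale v a + rscale v b.
Proof. exact: scalerDl. Qed.
Lemma rscaleNl v a : rscale (- v) a = - rscale v a.
Proof. exact: scalerN. Qed.
Lemma rscale0 v : rscale v 0 = 0.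
Proof. exact: scale0r. Qed.
Lemma rscale0l a : rscale (0 : V) a = 0.
Proof. exact: scaler0. Qed.
Lemma rscale_suml J (r : seq J) (P : pred J) (F : J -> V) a :
  rscale (\sum_(j <- r | P j) F j) a = \sum_(j <- r | P j) rscale (F j) a.
Proof. exact: scaler_sumr. Qed.
Lemma rscale_sumr J (r : seq J) (P : pred J) (F : J -> R) v :
  rscale v (\sum_(j <- r | P j) F j) = \sum_(j <- r | P j) rscale v (F j).
Proof. by apply: additive_sum => a b; apply: rscaleDr. Qed.
End Theory.

Section Build.
Variables (W : zmodType) (act : W -> R -> W).
Hypothesis actA : forall w a b, act (act w a) b = act w (a * b).
Hypothesis act1 : forall w, act w 1 = w.
Hypothesis actDl : forall v w a, act (v + w) a = act v a + act w a.
Hypothesis actDr : forall w a b, act w (a + b) = act w a + act w b.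

Let scale (a : GRing.converse R) (w : W) := act w a.
Let scaleA a b w : scale a (scale b w) = scale (a * b) w.
Proof. exact: actA. Qed.
Let scale1 : left_id 1 scale.
Proof. exact: act1. Qed.
Let scaleDr : right_distributive scale +%R.
Proof. by move=> a v w; apply: actDl. Qed.
Let scaleDl w : {morph scale^~ w : a b / a + b}.
Proof. by move=> a b; apply: actDr. Qed.

(* The proofs are recorded in the carrier, for the module structure to be
   inferred from it. *)
Definition act_sort : Type := let _ := (scaleA, scale1, scaleDr, scaleDl) in W.
HB.instance Definition _ := GRing.Zmodule.copy act_sort W.
HB.instance Definition _ := GRing.Zmodule_isLmodule.Build (GRing.converse R)
  act_sort scaleA scale1 scaleDr scaleDl.
Definition rmod_of_act : rmodType R := act_sort.
End Build.

Section Linear.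
Variables (U V : rmodType R) (f : U -> V).
Hypothesis fD : {morph f : x y / x + y}.
Hypothesis fZ : forall u a, f (rscale u a) = rscale (f u) a.

Let f_linear : linear f.
Proof. by move=> a u v; rewrite fD; congr (_ + _); apply: (fZ u a). Qed.

Definition rlinear_of : {linear U -> V} :=
  HB.pack f (GRing.isLinear.Build (GRing.converse R) U V *:%R f f_linear).

Lemma rlinear_ofE u : rlinear_of u = f u. Proof. by []. Qed.
End Linear.

Lemma rlinearZ (U V : rmodType R) (f : {linear U -> V}) u a :
  f (rscale u a) = rscale (f u) a.
Proof. exact: linearZ. Qed.
End RightModules.

(** * Modules over a tensor algebra *)

Section TensorAlgebraModules.
Variables (R : pzRingType) (M : bimodType R R).
Local Notation T := (tensor_alg M).

Definition tdeg0 (a : R) : T := a *: tone M.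
(** Degree 1 of the tensor algebra is M (x) R rather than M, so an element x of M enters it as x (x)
    1. *)
Definition tdeg1 (x : M) : T := tshift x (tone M).

Lemma tmulE (f g : T) : f * g = tmul f g. Proof. by []. Qed.

Lemma tdeg0_mul a (f : T) : tdeg0 a * f = a *: f.
Proof. by rewrite tmulE tmulZ tmul1. Qed.
Lemma tdeg1_mul x (f : T) : tdeg1 x * f = tshift x f.
Proof. by rewrite tmulE tmul_tshift tmul1. Qed.
Lemma tdeg0_1 : tdeg0 1 = 1.
Proof. exact: scale1r. Qed.
Lemma tdeg0M a b : tdeg0 (a * b) = tdeg0 a * tdeg0 b.
Proof. by rewrite tdeg0_mul /tdeg0 scalerA. Qed.
Lemma tdeg0D a b : tdeg0 (a + b) = tdeg0 a + tdeg0 b.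
Proof. exact: scalerDl. Qed.
Lemma tdeg1D x y : tdeg1 (x + y) = tdeg1 x + tdeg1 y.
Proof. exact: tshiftDl. Qed.
Lemma tdeg1_lact a x : tdeg1 (lact a x) = tdeg0 a * tdeg1 x.
Proof. by rewrite tdeg0_mul /tdeg1 tshiftZ. Qed.
Lemma tdeg1_ract a x : tdeg1 (ract x a) = tdeg1 x * tdeg0 a.
Proof. by rewrite tdeg1_mul -tshift_bal. Qed.

(** The tensor algebra is additively spanned by the products x_1 ... x_n a of elements of degree 1
    followed by one of degree 0; the induction peels off the factors from the left. *)
Lemma talg_ind (P : T -> Prop) :
  (forall f g, P f -> P g -> P (f + g)) ->
  (forall a, P (tdeg0 a)) ->
  (forall x f, P f -> P (tdeg1 x * f)) -> forall f, P f.
Proof.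
move=> PD P0 P1 f.
have Pz : P 0 by rewrite -[0](scale0r (tone M)); apply: P0.
(* Unfolding the product f * 1 cuts f into the terms [tact (f n) 1], one for each degree. *)
rewrite -[f]mulr1 tmulE /tmul; elim/big_ind: _ => // n _.
elim: (n : nat) (f n) => [|m IHm] t; first exact: P0.
move: t; apply: tens_ind => [|t u Pt Pu|x t].
- by rewrite tact0l.
- by rewrite (tactDl 1 (t : tpow M m.+1)); apply: PD.
- by rewrite -/(ltens x t) tactS -tdeg1_mul; apply: P1.
Qed.

Section Action.
(** With the hypotheses below, [m] is the curried form of an R-linear map from W (x) M to W. *)
Variables (W : rmodType R) (m : W -> M -> W).
Hypothesis mDl : forall v w x, m (v + w) x = m v x + m w x.
Hypothesis mDr : forall w x y, m w (x + y) = m w x + m w y.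
Hypothesis m_lact : forall w a x, m (rscale w a) x = m w (lact a x).
Hypothesis m_ract : forall w x a, m w (ract x a) = rscale (m w x) a.

(* The action of degree n, determined by w (x (x) t) = (w x) t. *)
Fixpoint pact (n : nat) : tpow M n -> W -> W :=
  match n return tpow M n -> W -> W with
  | 0 => fun a w => rscale w (a : R)
  | n'.+1 => fun t w => tens_lift (fun x t' => pact t' (m w x)) t
  end.

(** The three identities need a joint induction: [pact] in degree n + 1 is a lift from a tensor
    product, and the lift is well defined by all three identities in degree n. *)
Lemma pact_lin n :
  [/\ forall w (t u : tpow M n), pact (t + u) w = pact t w + pact u w,
      forall a (t : tpow M n) w, pact (a *: t) w = pact t (rscale w a) &
      forall (t : tpow M n) v w, pact t (v + w) = pact t v + pact t w].
Proof.
elim: n => [|n [IHDl IHZ IHDr]].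
  split=> [w t u|a t w|t v w] /=.
  - exact: rscaleDr.
  - by rewrite rscaleA.
  - exact: rscaleDl.
have bDl w (x y : M) (t : tpow M n) :
    pact t (m w (x + y)) = pact t (m w x) + pact t (m w y).
  by rewrite mDr IHDr.
have bDr w (x : M) (t u : tpow M n) :
    pact (t + u) (m w x) = pact t (m w x) + pact u (m w x).
  exact: IHDl.
have bB w (x : M) a (t : tpow M n) :
    pact t (m w (ract x a)) = pact (a *: t) (m w x).
  by rewrite IHZ m_ract.
have liftD w := tens_liftD (bDl w) (bDr w) (bB w).
have liftE w := tens_liftE (bDl w) (bDr w) (bB w).
split=> [w t u|a t w|t v w]; first exact: liftD.
- move: t; apply: (tens_ext 
    (f := fun t => @pact n.+1 (a *: (t : tpow M n.+1)) w)
    (g := fun t => @pact n.+1 t (rscale w a))) => [t u|t u|x t].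
  + by rewrite scalerDr [LHS]liftD.
  + exact: liftD.
  + rewrite [X in pact X _]ltens_scaleE [LHS]liftE /= liftE.
    by rewrite m_lact.
- move: t; apply: (tens_ext (f := fun t => @pact n.+1 t (v + w))
    (g := fun t => @pact n.+1 t v + @pact n.+1 t w)) => [t u|t u|x t].
  + exact: liftD.
  + by rewrite ![pact (_ + _) _]liftD addrACA.
  + by rewrite /= !liftE mDl IHDr.
Qed.

Lemma pactDl n w (t u : tpow M n) : pact (t + u) w = pact t w + pact u w.
Proof. by case: (pact_lin n). Qed.
Lemma pactZ n a (t : tpow M n) w : pact (a *: t) w = pact t (rscale w a).
Proof. by case: (pact_lin n). Qed.
Lemma pactDr n (t : tpow M n) v w : pact t (v + w) = pact t v + pact t w.
Proof. by case: (pact_lin n). Qed.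
Lemma pact0 n w : pact (0 : tpow M n) w = 0.
Proof. by apply: (addrI (pact (0 : tpow M n) w)); rewrite -pactDl !addr0. Qed.

Lemma pactS n x (t : tpow M n) w : @pact n.+1 (ltens x t) w = pact t (m w x).
Proof.
apply: (tens_liftE (f := fun x t' => pact t' (m w x))) => *.
- by rewrite mDr pactDr.
- exact: pactDl.
- by rewrite pactZ m_ract.
Qed.

Definition talg_act (w : W) (f : T) : W :=
  \sum_(n < sval (dsum_bound f)) pact (f n) w.

(** [dsum_bound] chooses an unspecified bound on the degrees of f. Any other bound gives the same
    sum, which allows a common bound for several elements. *)
Lemma talg_act_widen N w (f : T) : (forall n, (N <= n)%N -> f n = 0) ->
  talg_act w f = \sum_(n < N) pact (f n) w.
Proof.
have aux N1 N2 : (N1 <= N2)%N -> (forall n, (N1 <= n)%N -> f n = 0) ->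
    \sum_(n < N1) pact (f n) w = \sum_(n < N2) pact (f n) w.
  move=> le12 f0; rewrite (big_ord_widen _ (fun n => pact (f n) w) le12).
  rewrite big_mkcond; apply: eq_bigr => n _; case: ifPn => //.
  by rewrite -leqNgt => /f0 ->; rewrite pact0.
move=> fN; rewrite /talg_act; case: dsum_bound => N' fN' /=.
case/orP: (leq_total N N') => le; first by rewrite -(aux _ _ le).
by rewrite (aux _ _ le).
Qed.

Lemma talg_actDl v w f : talg_act (v + w) f = talg_act v f + talg_act w f.
Proof.
by rewrite /talg_act -big_split; apply: eq_bigr => n _; apply: pactDr.
Qed.

Lemma talg_actDr w f g : talg_act w (f + g) = talg_act w f + talg_act w g.
Proof.
have [N fN] := dsum_bound f; have [N' gN] := dsum_bound g.
have le n : (maxn N N' <= n)%N -> (N <= n)%N /\ (N' <= n)%N.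
  by rewrite geq_max => /andP.
rewrite (@talg_act_widen (maxn N N') _ f); last by move=> n /le[/fN].
rewrite (@talg_act_widen (maxn N N') _ g); last by move=> n /le[_ /gN].
rewrite (@talg_act_widen (maxn N N') _ (f + g)); last first.
  by move=> n /le[/fN fn /gN gn]; rewrite dsumDE fn gn addr0.
by rewrite -big_split; apply: eq_bigr => n _; apply: pactDl.
Qed.

Lemma talg_actZ w a f : talg_act w (a *: f) = talg_act (rscale w a) f.
Proof.
have [N fN] := dsum_bound f; rewrite !(@talg_act_widen N) //; last first.
  by move=> n /fN fn; rewrite dsumZE fn scaler0.
by apply: eq_bigr => n _; rewrite dsumZE pactZ.
Qed.

Lemma talg_act_tshift w x f : talg_act w (tshift x f) = talg_act (m w x) f.
Proof.
have [N fN] := dsum_bound f.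
(* The shift raises degrees by one: the bound becomes N + 1 and the component of degree 0 is
   zero. *)
rewrite (@talg_act_widen N.+1); last first.
  by move=> [|n] //= Nn; rewrite fN // ltensx0.
rewrite (talg_act_widen _ fN) big_ord_recl [X in X + _]pact0 add0r.
by apply: eq_bigr => n _; rewrite -pactS.
Qed.

Lemma talg_act_one w : talg_act w 1 = w.
Proof.
rewrite (@talg_act_widen 1); last by move=> [|n] // _; apply: homog_neq.
by rewrite big_ord1 homogE /= rscale1.
Qed.

Lemma talg_act_deg0 w a : talg_act w (tdeg0 a) = rscale w a.
Proof. by rewrite talg_actZ talg_act_one. Qed.
Lemma talg_act_deg1 w x : talg_act w (tdeg1 x) = m w x.
Proof. by rewrite talg_act_tshift talg_act_one. Qed.

(** Induction on f for all w at once, since peeling off a left factor x of degree 1 replaces w by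
    [m w x]. *)
Lemma talg_actA w f g : talg_act (talg_act w f) g = talg_act w (f * g).
Proof.
move: f w; apply: talg_ind => [f f' IH IH'|a|x f IHf] w.
- by rewrite talg_actDr talg_actDl mulrDl talg_actDr IH IH'.
- by rewrite talg_act_deg0 tdeg0_mul talg_actZ.
- by rewrite -mulrA !tdeg1_mul !talg_act_tshift IHf.
Qed.

Definition talg_mod : rmodType T :=
  rmod_of_act talg_actA talg_act_one talg_actDl talg_actDr.

Lemma talg_mod_deg0 (w : talg_mod) a : rscale w (tdeg0 a) = rscale (w : W) a.
Proof. exact: talg_act_deg0. Qed.
Lemma talg_mod_deg1 (w : talg_mod) x : rscale w (tdeg1 x) = m w x.
Proof. exact: talg_act_deg1. Qed.
End Action.

(** As degrees 0 and 1 generate the tensor algebra, linearity has only to be checked on them. *)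
Lemma talg_linear (U V : rmodType T) (f : U -> V) : {morph f : x y / x + y} ->
  (forall u a, f (rscale u (tdeg0 a)) = rscale (f u) (tdeg0 a)) ->
  (forall u x, f (rscale u (tdeg1 x)) = rscale (f u) (tdeg1 x)) ->
  forall u t, f (rscale u t) = rscale (f u) t.
Proof.
move=> fD f0 f1 u t; move: t u; apply: talg_ind => // [s t IHs IHt|x t IHt] u.
  by rewrite !rscaleDr fD IHs IHt.
by rewrite -!rscaleA IHt f1.
Qed.
End TensorAlgebraModules.

(** * Coordinate injections into a finite product *)

Section Injections.
Variables (I : finType) (P : I -> zmodType).

Definition dinj i (x : P i) : dprod P := dfwith (T := P) (fun=> 0) x.

Lemma dinjE i (x : P i) : dinj x i = x.
Proof. exact: dfwith_in. Qed.
Lemma dinj_neq i j (x : P i) : i != j -> dinj x j = 0.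
Proof. exact: dfwith_out. Qed.
Lemma dinjD i (x y : P i) : dinj (x + y) = dinj x + dinj y.
Proof.
apply: dprodP => j; rewrite dprodDE; have [<-|ij] := eqVneq i j.
  by rewrite !dinjE.
by rewrite !dinj_neq ?addr0.
Qed.
Lemma dinj0 i : dinj (0 : P i) = 0.
Proof. exact: additive0 (@dinjD i). Qed.

Lemma dprod_sumE (J : Type) (r : seq J) (Q : pred J) (F : J -> dprod P) i :
  (\sum_(j <- r | Q j) F j) i = \sum_(j <- r | Q j) F j i.
Proof. exact: (additive_sum (f := fun x : dprod P => x i)). Qed.

Lemma sum_dinj (x : dprod P) : \sum_i dinj (x i) = x.
Proof.
apply: dprodP => j; rewrite dprod_sumE (bigD1 j) //= dinjE big1 ?addr0 //.
by move=> i ij; rewrite dinj_neq.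
Qed.
End Injections.

Lemma lact0 (R S : pzRingType) (N : bimodType R S) (a : R) : lact a (0 : N) = 0.
Proof. by apply: additive0 => x y; apply: lactDr. Qed.
Lemma lact0l (R S : pzRingType) (N : bimodType R S) (x : N) : lact 0 x = 0.
Proof.
by apply: (additive0 (f := fun a => lact a x)) => a b; apply: lactDl.
Qed.
Lemma ract0 (R S : pzRingType) (N : bimodType R S) (a : S) : ract (0 : N) a = 0.
Proof.
by apply: (additive0 (f := fun x : N => ract x a)) => x y; apply: ractDl.
Qed.
Lemma ract0r (R S : pzRingType) (N : bimodType R S) (x : N) : ract x 0 = 0.
Proof. by apply: additive0 => a b; apply: ractDr. Qed.

(** * Vertex components *)

Section VertexComponents.
Variables (k : fieldType) (M : premodulation k).
Local Notation I := (pm_vertex M).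
Local Notation A0 := (prod_ring (fun i : I => pm_alg i : pzRingType)).
Local Notation B := (sum_bimod (@pm_bimod k M)).
Local Notation T := (tensor_alg B).

(** This injection is not unital: [ainj 1] is the idempotent e_i of A_0. *)
Definition ainj (i : I) (a : pm_alg i) : A0 :=
  dinj (P := fun i => pm_alg i : zmodType) a.
Definition binj (i j : I) (x : pm_bimod i j) : B :=
  dinj (P := fun ij : I * I => pm_bimod ij.1 ij.2) (i := (i, j)) x.

Lemma ainjD i (a b : pm_alg i) : ainj (a + b) = ainj a + ainj b.
Proof. exact: dinjD. Qed.
Lemma ainjM i (a b : pm_alg i) : ainj (a * b) = ainj a * ainj b.
Proof.
apply: dprodP => j; rewrite -[RHS]/(ainj a j * ainj b j).
have [<-|ij] := eqVneq i j; first by rewrite /ainj !dinjE.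
by rewrite /ainj !dinj_neq // mulr0.
Qed.
Lemma mul_ainj (a : A0) i : a * ainj (1 : pm_alg i) = ainj (a i).
Proof.
apply: dprodP => j; rewrite -[LHS]/(a j * ainj (1 : pm_alg i) j).
have [<-|ij] := eqVneq i j; first by rewrite /ainj !dinjE mulr1.
by rewrite /ainj !dinj_neq // mulr0.
Qed.
Lemma ainj_mul (a : A0) i : ainj (1 : pm_alg i) * a = ainj (a i).
Proof.
apply: dprodP => j; rewrite -[LHS]/(ainj (1 : pm_alg i) j * a j).
have [<-|ij] := eqVneq i j; first by rewrite /ainj !dinjE mul1r.
by rewrite /ainj !dinj_neq // mul0r.
Qed.
Lemma sum_ainj (a : A0) : \sum_i ainj (a i) = a.
Proof. exact: sum_dinj. Qed.

Lemma binjD i j (x y : pm_bimod i j) : binj (x + y) = binj x + binj y.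
Proof. exact: dinjD. Qed.
Lemma sum_binj (x : B) : \sum_ij binj (x ij) = x.
Proof.
rewrite -[RHS](sum_dinj (P := fun ij : I * I => pm_bimod ij.1 ij.2)).
by apply: eq_bigr => -[i j] _.
Qed.
Lemma lact_binj (a : A0) i j (x : pm_bimod i j) :
  lact a (binj x) = binj (lact (a i) x).
Proof.
apply: dprodP => ij; rewrite -[LHS]/(lact (a ij.1) (binj x ij)).
have [<-|neq] := eqVneq (i, j) ij; first by rewrite /binj !dinjE.
by rewrite /binj !dinj_neq // lact0.
Qed.
Lemma ract_binj (a : A0) i j (x : pm_bimod i j) :
  ract (binj x) a = binj (ract x (a j)).
Proof.
apply: dprodP => ij; rewrite -[LHS]/(ract (binj x ij) (a ij.2)).
have [<-|neq] := eqVneq (i, j) ij; first by rewrite /binj !dinjE.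
by rewrite /binj !dinj_neq // ract0.
Qed.

Definition vdeg0 i (a : pm_alg i) : T := tdeg0 B (ainj a).
Definition vdeg1 i j (x : pm_bimod i j) : T := tdeg1 (binj x).

Lemma vdeg0D i (a b : pm_alg i) : vdeg0 (a + b) = vdeg0 a + vdeg0 b.
Proof. by rewrite /vdeg0 ainjD tdeg0D. Qed.
Lemma vdeg0M i (a b : pm_alg i) : vdeg0 (a * b) = vdeg0 a * vdeg0 b.
Proof. by rewrite /vdeg0 ainjM tdeg0M. Qed.
Lemma vdeg1D i j (x y : pm_bimod i j) : vdeg1 (x + y) = vdeg1 x + vdeg1 y.
Proof. by rewrite /vdeg1 binjD tdeg1D. Qed.
Lemma vdeg1_0 i j : vdeg1 (0 : pm_bimod i j) = 0.
Proof. by apply: additive0 => x y; apply: vdeg1D. Qed.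
Lemma vdeg1_lact i j a (x : pm_bimod i j) :
  vdeg1 (lact a x) = vdeg0 a * vdeg1 x.
Proof. by rewrite /vdeg0 -tdeg1_lact lact_binj /ainj dinjE. Qed.
Lemma vdeg1_ract i j a (x : pm_bimod i j) :
  vdeg1 (ract x a) = vdeg1 x * vdeg0 a.
Proof. by rewrite /vdeg0 -tdeg1_ract ract_binj /ainj dinjE. Qed.
Lemma tdeg0_sum (a : A0) : tdeg0 B a = \sum_i vdeg0 (a i).
Proof.
rewrite -[in LHS](sum_ainj a); apply: additive_sum => b c; exact: tdeg0D.
Qed.
Lemma tdeg1_sum (x : B) : tdeg1 x = \sum_ij vdeg1 (x ij).
Proof.
rewrite -[in LHS](sum_binj x); apply: additive_sum => y z; exact: tdeg1D.
Qed.

Lemma vdeg0_deg0 i (a : A0) :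
  vdeg0 (1 : pm_alg i) * tdeg0 B a = vdeg0 (a i).
Proof. by rewrite /vdeg0 -tdeg0M ainj_mul. Qed.
Lemma deg0_vdeg0 i (a : A0) :
  tdeg0 B a * vdeg0 (1 : pm_alg i) = vdeg0 (a i).
Proof. by rewrite /vdeg0 -tdeg0M mul_ainj. Qed.
(** The element e_i acts on the left of x through its coordinate at i', which is 0. *)
Lemma vdeg1_neql i i' j (x : pm_bimod i' j) : i' != i ->
  vdeg0 (1 : pm_alg i) * vdeg1 x = 0.
Proof.
move=> ii'; rewrite /vdeg0 -tdeg1_lact lact_binj /ainj dinj_neq 1?eq_sym //.
by rewrite lact0l; apply: vdeg1_0.
Qed.
Lemma vdeg1_neqr i j j' (x : pm_bimod i j') : j' != j ->
  vdeg1 x * vdeg0 (1 : pm_alg j) = 0.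
Proof.
move=> jj'; rewrite /vdeg0 -tdeg1_ract ract_binj /ainj dinj_neq 1?eq_sym //.
by rewrite ract0r; apply: vdeg1_0.
Qed.
(** Seen as a matrix with entries in the bimodules, x keeps only its row i under left multiplication
    by e_i. *)
Lemma vdeg0_deg1 i (x : B) :
  vdeg0 (1 : pm_alg i) * tdeg1 x = \sum_j vdeg1 (x (i, j) : pm_bimod i j).
Proof.
rewrite tdeg1_sum mulr_sumr.
rewrite (eq_bigr (fun ij => vdeg0 (1 : pm_alg i) *
  vdeg1 (x (ij.1, ij.2) : pm_bimod ij.1 ij.2))) => [|[] //].
rewrite -(pair_bigA _ (fun i' j => vdeg0 (1 : pm_alg i) *
  vdeg1 (x (i', j) : pm_bimod i' j)))
  (bigD1 i) //= [X in _ + X]big1 => [|i' i'i].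
  by rewrite addr0; apply: eq_bigr => j _; rewrite -vdeg1_lact lact1.
by rewrite big1 // => j _; apply: vdeg1_neql.
Qed.
Lemma deg1_vdeg0 j (x : B) :
  tdeg1 x * vdeg0 (1 : pm_alg j) = \sum_i vdeg1 (x (i, j) : pm_bimod i j).
Proof.
rewrite tdeg1_sum mulr_suml.
rewrite (eq_bigr (fun ij => vdeg1 (x (ij.1, ij.2) : pm_bimod ij.1 ij.2) *
  vdeg0 (1 : pm_alg j))) => [|[] //].
rewrite -(pair_bigA _ (fun i j' => vdeg1 (x (i, j') : pm_bimod i j') *
  vdeg0 (1 : pm_alg j))); apply: eq_bigr => i _ /=.
rewrite (bigD1 j) //= big1 => [|j' j'j]; last exact: vdeg1_neqr.
by rewrite addr0 -vdeg1_ract ract1.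
Qed.
Lemma sum_vdeg0 : \sum_i vdeg0 (1 : @pm_alg k M i) = 1.
Proof. by rewrite -tdeg0_1 tdeg0_sum. Qed.

Section Component.
Variables (W : rmodType T) (i : I).

(** The component W e_i is encoded as the set of fixed points of the idempotent e_i, which is its
    image; a boolean equation lets the subgroup structure be inherited. *)
Definition vtx_pred : {pred W} := fun w => rscale w (vdeg0 (1 : pm_alg i)) == w.

Lemma vtx_zmod_closed : zmod_closed vtx_pred.
Proof.
split=> [|v w]; rewrite !unfold_in; first by rewrite rscale0l.
by move=> /eqP vE /eqP wE; rewrite rscaleDl rscaleNl vE wE.
Qed.
HB.instance Definition _ := GRing.isZmodClosed.Build W vtx_pred vtx_zmod_closed.

Record vtx := Vtx { vtx_val : W; _ : vtx_pred vtx_val }.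
HB.instance Definition _ := [isSub for vtx_val].
HB.instance Definition _ := [Choice of vtx by <:].
HB.instance Definition _ := [SubChoice_isSubZmodule of vtx by <:].

Lemma vtxP (w : vtx) : rscale (val w) (vdeg0 (1 : pm_alg i)) = val w.
Proof. by case: w => w /= /eqP. Qed.

(** Here w ranges over all of W, so that the case a = 1 also yields the projection [vtx_proj] onto
    the component. *)
Lemma vtx_act_subproof (w : W) (a : pm_alg i) : vtx_pred (rscale w (vdeg0 a)).
Proof. by rewrite /vtx_pred rscaleA -vdeg0M mulr1. Qed.
Definition vtx_act (w : vtx) (a : pm_alg i) : vtx :=
  Vtx (vtx_act_subproof (val w) a).

Let actA w a b : vtx_act (vtx_act w a) b = vtx_act w (a * b).
Proof. by apply: val_inj; rewrite /= rscaleA vdeg0M. Qed.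
Let act1 w : vtx_act w 1 = w.
Proof. by apply: val_inj; rewrite /= vtxP. Qed.
Let actDl v w a : vtx_act (v + w) a = vtx_act v a + vtx_act w a.
Proof. by apply: val_inj; rewrite /= rscaleDl. Qed.
Let actDr w a b : vtx_act w (a + b) = vtx_act w a + vtx_act w b.
Proof. by apply: val_inj; rewrite /= vdeg0D rscaleDr. Qed.

Definition vtx_mod : rmodType (pm_alg i) := rmod_of_act actA act1 actDl actDr.

Definition vtx_incl (w : vtx_mod) : W := vtx_val w.

Lemma vtx_inclD v w : vtx_incl (v + w) = vtx_incl v + vtx_incl w.
Proof. by []. Qed.
Lemma vtx_inclZ v a : vtx_incl (rscale v a) = rscale (vtx_incl v) (vdeg0 a).
Proof. by []. Qed.
Lemma vtx_incl_inj : injective vtx_incl.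
Proof. exact: val_inj. Qed.
Lemma vtx_inclP w : rscale (vtx_incl w) (vdeg0 (1 : pm_alg i)) = vtx_incl w.
Proof. exact: vtxP. Qed.

Definition vtx_proj (w : W) : vtx_mod := Vtx (vtx_act_subproof w 1).
Lemma vtx_projK w : vtx_incl (vtx_proj w) = rscale w (vdeg0 (1 : pm_alg i)).
Proof. by []. Qed.
End Component.

End VertexComponents.
Arguments vtx_pred {k M} W i.

(** * The two functors *)

Section RtensorLift.
Variables (R S : pzRingType) (V : rmodType R) (N : bimodType R S).
Variable U : rmodType S.
Variable f : V -> N -> U.
Hypothesis fDl : forall v w x, f (v + w) x = f v x + f w x.
Hypothesis fDr : forall v x y, f v (x + y) = f v x + f v y.
Hypothesis f_bal : forall v a x, f (rscale v a) x = f v (lact a x).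
Hypothesis f_ract : forall v x a, f v (ract x a) = rscale (f v x) a.

Let lift (t : rtensor V N) : U := tens_lift f t.
Let liftE v x : lift (rtens v x) = f v x.
Proof. exact: tens_liftE fDl fDr f_bal v x. Qed.
Let liftD : {morph lift : t u / t + u}.
Proof. exact: tens_liftD fDl fDr f_bal. Qed.
Let liftZ t a : lift (rscale t a) = rscale (lift t) a.
Proof.
move: t; apply: (tens_ext (f := fun t => lift (rscale (t : rtensor V N) a))
  (g := fun t => rscale (lift t) a)) => [t u|t u|v x].
- by rewrite rscaleDl liftD.
- by rewrite liftD rscaleDl.
- rewrite -[tens _ _ v x]/(rtens v x) [rscale _ _](rtens_scaleE a v x).
  by rewrite !liftE f_ract.
Qed.

Definition rtensor_lift : {linear rtensor V N -> U} := rlinear_of liftD liftZ.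

Lemma rtensor_liftE v x : rtensor_lift (rtens v x) = f v x.
Proof. exact: liftE. Qed.
End RtensorLift.

Lemma rtensor_ext (R S : pzRingType) (V : rmodType R) (N : bimodType R S)
    (U : zmodType) (f g : rtensor V N -> U) :
  {morph f : x y / x + y} -> {morph g : x y / x + y} ->
  (forall v x, f (rtens v x) = g (rtens v x)) -> f =1 g.
Proof. exact: tens_ext. Qed.

Section RtensTheory.
Variables (R S : pzRingType) (V : rmodType R) (N : bimodType R S).
Implicit Types (v w : V) (x y : N).

Lemma rtensDl v w x : rtens (v + w) x = rtens v x + rtens w x.
Proof. exact: tensDl. Qed.
Lemma rtensDr v x y : rtens v (x + y) = rtens v x + rtens v y.
Proof. exact: tensDr. Qed.
Lemma rtens_bal v a x : rtens (rscale v a) x = rtens v (lact a x).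
Proof. exact: tens_bal. Qed.
Lemma rtens_ract v x a : rtens v (ract x a) = rscale (rtens v x) a.
Proof. by symmetry; apply: rtens_scaleE. Qed.
End RtensTheory.

Section Functors.
Variables (k : fieldType) (M : premodulation k).
Local Notation I := (pm_vertex M).
Local Notation A0 := (prod_ring (fun i : I => pm_alg i : pzRingType)).
Local Notation B := (sum_bimod (@pm_bimod k M)).
Local Notation T := (tensor_alg B).

Section ModuleToRep.
Variable W : rmodType T.

(** Since x e_j = x for x in iMj, the action of x lands in W e_j. *)
Lemma vtx_arr_subproof i j (w : vtx_mod W i) (x : pm_bimod i j) :
  vtx_pred W j (rscale (vtx_incl w) (vdeg1 x)).
Proof. by rewrite /vtx_pred rscaleA -vdeg1_ract ract1. Qed.
Definition vtx_arr i j (w : vtx_mod W i) (x : pm_bimod i j) : vtx_mod W j :=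
  Vtx (vtx_arr_subproof w x).

Lemma vtx_arrE i j (w : vtx_mod W i) (x : pm_bimod i j) :
  vtx_incl (vtx_arr w x) = rscale (vtx_incl w) (vdeg1 x).
Proof. by []. Qed.

Lemma vtx_arrDl i j v w (x : pm_bimod i j) :
  vtx_arr (v + w) x = vtx_arr v x + vtx_arr w x.
Proof. by apply: vtx_incl_inj; apply: rscaleDl. Qed.
Lemma vtx_arrDr i j v (x y : pm_bimod i j) :
  vtx_arr v (x + y) = vtx_arr v x + vtx_arr v y.
Proof.
by apply: vtx_incl_inj; rewrite vtx_inclD !vtx_arrE vdeg1D rscaleDr.
Qed.
Lemma vtx_arr_bal i j v a (x : pm_bimod i j) :
  vtx_arr (rscale v a) x = vtx_arr v (lact a x).
Proof.
by apply: vtx_incl_inj; rewrite [LHS]rscaleA -vdeg1_lact.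
Qed.
Lemma vtx_arr_ract i j v (x : pm_bimod i j) a :
  vtx_arr v (ract x a) = rscale (vtx_arr v x) a.
Proof.
by apply: vtx_incl_inj; rewrite vtx_inclZ [RHS]rscaleA -vdeg1_ract.
Qed.

Definition mod_rep : representation M :=
  @Representation k M (vtx_mod W) (fun i j _ =>
    rtensor_lift (@vtx_arrDl i j) (@vtx_arrDr i j) (@vtx_arr_bal i j)
      (@vtx_arr_ract i j)).

Lemma mod_rep_mapE i j (e : edge i j) (w : vtx_mod W i) (x : pm_bimod i j) :
  vtx_incl (rep_map mod_rep e (rtens w x)) = rscale (vtx_incl w) (vdeg1 x).
Proof. by rewrite [rep_map _ _ _]rtensor_liftE. Qed.
End ModuleToRep.

Section ModuleToRepMap.
Variables (U W : rmodType T) (f : {linear U -> W}).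

Lemma vtx_map_subproof i (u : vtx_mod U i) : vtx_pred W i (f (vtx_incl u)).
Proof. by rewrite /vtx_pred -rlinearZ vtx_inclP. Qed.
Let vmap i (u : vtx_mod U i) : vtx_mod W i := Vtx (vtx_map_subproof u).
Let vmapD i : {morph @vmap i : u v / u + v}.
Proof.
by move=> u v; apply: vtx_incl_inj; rewrite vtx_inclD /vmap /vtx_incl /= raddfD.
Qed.
Let vmapZ i (u : vtx_mod U i) a : vmap (rscale u a) = rscale (vmap u) a.
Proof. by apply: vtx_incl_inj; rewrite vtx_inclZ -[RHS]rlinearZ. Qed.

Definition vtx_map i : {linear vtx_mod U i -> vtx_mod W i} :=
  rlinear_of (@vmapD i) (@vmapZ i).
Lemma vtx_mapE i u : vtx_incl (vtx_map i u) = f (vtx_incl u).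
Proof. by []. Qed.

(** On a pure tensor u (x) x this is the linearity of f with respect to the element x of degree
    1. *)
Lemma mod_rep_hom_comm i j (e : edge i j)
    (x : rtensor (mod_rep U i) (pm_bimod i j)) :
  vtx_map j (rep_map (mod_rep U) e x) =
  rep_map (mod_rep W) e (rtensor_map (vtx_map i) x).
Proof.
move: x; apply: rtensor_ext => [x y|x y|u x]; first by rewrite !raddfD.
  by rewrite rtensor_mapD raddfD.
apply: vtx_incl_inj; rewrite vtx_mapE rtensor_mapE !mod_rep_mapE vtx_mapE.
exact: rlinearZ.
Qed.
Definition mod_rep_hom : rep_hom (mod_rep U) (mod_rep W) :=
  @RepHom k M (mod_rep U) (mod_rep W) vtx_map mod_rep_hom_comm.
End ModuleToRepMap.

Definition mod_to_rep : functor (Mod T) (Rep M).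
Proof.
refine (@Functor (Mod T) (Rep M) mod_rep mod_rep_hom _ _).
- by move=> U; apply: rep_hom_ext => i u; apply: vtx_incl_inj.
- by move=> U V W f g; apply: rep_hom_ext => i u; apply: vtx_incl_inj.
Defined.

Section RepToModule.
Variable V : representation M.

(* Off the edges, the bimodule is zero and so is the map. *)
Definition arr (i j : I) (v : V i) (x : pm_bimod i j) : V j :=
  if pselect (edge i j) is left e then rep_map V e (rtens v x) else 0.

(** The map [rep_map] takes a proof of [edge i j] as argument; by proof irrelevance, the one found
    by [pselect] can be replaced by any other. *)
Lemma arrE i j (e : edge i j) (v : V i) (x : pm_bimod i j) :
  arr v x = rep_map V e (rtens v x).
Proof.
by rewrite /arr; case: pselect => // e'; rewrite (Prop_irrelevance e e').
Qed.
Lemma arrDl i j v w (x : pm_bimod i j) : arr (v + w) x = arr v x + arr w x.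
Proof.
by rewrite /arr; case: pselect => [e|_]; rewrite ?addr0 // rtensDl raddfD.
Qed.
Lemma arrDr i j v (x y : pm_bimod i j) : arr v (x + y) = arr v x + arr v y.
Proof.
by rewrite /arr; case: pselect => [e|_]; rewrite ?addr0 // rtensDr raddfD.
Qed.
Lemma arr_bal i j v a (x : pm_bimod i j) :
  arr (rscale v a) x = arr v (lact a x).
Proof. by rewrite /arr; case: pselect => [e|_] //; rewrite rtens_bal. Qed.
Lemma arr_ract i j v (x : pm_bimod i j) a :
  arr v (ract x a) = rscale (arr v x) a.
Proof.
rewrite /arr; case: pselect => [e|_]; last by rewrite rscale0l.
by rewrite rtens_ract rlinearZ.
Qed.
Lemma arr0r i j (v : V i) : arr v (0 : pm_bimod i j) = 0.
Proof. by apply: additive0 => x y; apply: arrDr. Qed.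

Local Notation P := (dprod (fun i => V i : zmodType)).
Definition prod_act (w : P) (a : A0) : P := fun i => rscale (w i) (a i).
Let prod_actA w a b : prod_act (prod_act w a) b = prod_act w (a * b).
Proof. by apply: dprodP => i; apply: rscaleA. Qed.
Let prod_act1 w : prod_act w 1 = w.
Proof. by apply: dprodP => i; apply: rscale1. Qed.
Let prod_actDl v w a : prod_act (v + w) a = prod_act v a + prod_act w a.
Proof. by apply: dprodP => i; apply: rscaleDl. Qed.
Let prod_actDr w a b : prod_act w (a + b) = prod_act w a + prod_act w b.
Proof. by apply: dprodP => i; apply: rscaleDr. Qed.
Definition prod_mod : rmodType A0 :=
  rmod_of_act prod_actA prod_act1 prod_actDl prod_actDr.

(** This is the product of the row vector w by the matrix x. *)
Definition prod_arr (w : prod_mod) (x : B) : prod_mod :=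
  fun j => \sum_i arr ((w : P) i) (x (i, j) : pm_bimod i j).
Let prod_arrDl v w x : prod_arr (v + w) x = prod_arr v x + prod_arr w x.
Proof.
apply: dprodP => j; rewrite /prod_arr dprodDE -big_split.
by apply: eq_bigr => i _; apply: arrDl.
Qed.
Let prod_arrDr w x y : prod_arr w (x + y) = prod_arr w x + prod_arr w y.
Proof.
apply: dprodP => j; rewrite /prod_arr dprodDE -big_split.
by apply: eq_bigr => i _; apply: arrDr.
Qed.
Let prod_arr_lact w a x : prod_arr (rscale w a) x = prod_arr w (lact a x).
Proof. by apply: dprodP => j; apply: eq_bigr => i _; apply: arr_bal. Qed.
Let prod_arr_ract w x a : prod_arr w (ract x a) = rscale (prod_arr w x) a.
Proof.
apply: dprodP => j; rewrite -[RHS]/(rscale (prod_arr w x j) (a j)) rscale_suml.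
by apply: eq_bigr => i _; apply: arr_ract.
Qed.

Definition rep_mod : rmodType T :=
  talg_mod prod_arrDl prod_arrDr prod_arr_lact prod_arr_ract.

(** These two identity casts record whether a family is read coordinatewise or as an element of the
    module over the tensor algebra. *)
Definition rep_mod_coord (w : rep_mod) : P := w.
Definition rep_mod_of (w : P) : rep_mod := w.

Lemma rep_mod_deg0 (w : rep_mod) a :
  rep_mod_coord (rscale w (tdeg0 B a)) =
  fun i => rscale (rep_mod_coord w i) (a i).
Proof.
exact: (@talg_mod_deg0 _ _ _ _ prod_arrDl prod_arrDr
  prod_arr_lact prod_arr_ract w a).
Qed.
Lemma rep_mod_deg1 (w : rep_mod) x :
  rep_mod_coord (rscale w (tdeg1 x)) =
  fun j => \sum_i arr (rep_mod_coord w i) (x (i, j) : pm_bimod i j).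
Proof.
exact: (@talg_mod_deg1 _ _ _ _ prod_arrDl prod_arrDr
  prod_arr_lact prod_arr_ract w x).
Qed.

Lemma rep_mod_vdeg0 (w : rep_mod) i (a : pm_alg i) :
  rep_mod_coord (rscale w (vdeg0 a)) = dinj (rscale (rep_mod_coord w i) a).
Proof.
rewrite rep_mod_deg0; apply: dprodP => j; have [<-|ij] := eqVneq i j.
  by rewrite /ainj !dinjE.
by rewrite /ainj !dinj_neq // rscale0.
Qed.
Lemma rep_mod_vdeg1 (w : rep_mod) i j (x : pm_bimod i j) :
  rep_mod_coord (rscale w (vdeg1 x)) = dinj (arr (rep_mod_coord w i) x).
Proof.
rewrite rep_mod_deg1; apply: dprodP => j'.
(* The matrix [binj x] has (i, j) as its only possibly nonzero entry, so only the summand i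
   survives, and only in coordinate j. *)
rewrite (bigD1 i) //= big1; last first.
  move=> i' i'i; rewrite /binj dinj_neq ?arr0r //.
  by apply: contraNneq i'i => -[->].
rewrite addr0 /binj; have [<-|jj'] := eqVneq j j'; first by rewrite !dinjE.
rewrite !dinj_neq ?arr0r //.
by apply: contraNneq jj' => -[->].
Qed.
End RepToModule.

Section RepToModuleMap.
Variables (U V : representation M) (f : rep_hom U V).

Lemma rep_hom_arr i j (u : U i) (x : pm_bimod i j) :
  f j (arr u x) = arr (f i u) x.
Proof.
rewrite /arr; case: pselect => [e|_]; last exact: raddf0.
by rewrite rep_hom_comm rtensor_mapE.
Qed.

Let pmap (u : rep_mod U) : rep_mod V :=
  rep_mod_of (fun i => f i (rep_mod_coord u i)).
Let pmapD : {morph pmap : u v / u + v}.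
Proof. by move=> u v; apply: dprodP => i; apply: raddfD. Qed.
Let pmapZ u t : pmap (rscale u t) = rscale (pmap u) t.
Proof.
apply: talg_linear u t => [|u a|u x]; first exact: pmapD.
- rewrite /pmap rep_mod_deg0 -[RHS]/(rep_mod_coord _) rep_mod_deg0.
  by apply: dprodP => i; apply: rlinearZ.
- rewrite /pmap rep_mod_deg1 -[RHS]/(rep_mod_coord _) rep_mod_deg1.
  apply: dprodP => j; rewrite [LHS]raddf_sum; apply: eq_bigr => i _.
  exact: rep_hom_arr.
Qed.
Definition rep_mod_map : {linear rep_mod U -> rep_mod V} :=
  rlinear_of pmapD pmapZ.
End RepToModuleMap.

Definition rep_to_mod : functor (Rep M) (Mod T).
Proof.
refine (@Functor (Rep M) (Mod T) rep_mod rep_mod_map _ _).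
- by move=> U; apply: linear_ext => u; apply: dprodP.
- by move=> U V W f g; apply: linear_ext => u; apply: dprodP.
Defined.
End Functors.

(** * The equivalence *)

Section RestrictFunctor.
Variables (C D : category) (P : C -> Prop) (Q : D -> Prop).

Definition full_functor (F : functor C D) (FP : forall x, P x -> Q (F x)) :
  functor (full_subcategory P) (full_subcategory Q).
Proof.
refine (@Functor (full_subcategory P) (full_subcategory Q)
  (fun x => exist Q (F (sval x)) (FP _ (svalP x))) (fun x y f => fmap F f) _ _).
- by move=> x; apply: fmap_id.
- by move=> x y z f g; apply: fmap_comp.
Defined.
End RestrictFunctor.

(** The functors are explicit because they must preserve P and Q. A full subcategory has the
    morphisms of the ambient category, so the components of both isomorphisms carry over
    unchanged. *)
Lemma full_equivalent (C D : category) (P : C -> Prop) (Q : D -> Prop)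
    (F : functor C D) (G : functor D C) :
  (forall x, P x -> Q (F x)) -> (forall y, Q y -> P (G y)) ->
  nat_iso (functor_comp G F) (functor_id C) ->
  nat_iso (functor_comp F G) (functor_id D) ->
  equivalent (full_subcategory P) (full_subcategory Q).
Proof.
move=> FP GQ eta eps; exists (full_functor FP), (full_functor GQ); split.
- constructor; case: eta => h h' hK h'K hnat.
  refine (@NatIso (full_subcategory P) _
    (functor_comp (full_functor GQ) (full_functor FP)) (functor_id _)
    (fun x => h (sval x)) (fun x => h' (sval x)) _ _ _).
  + by move=> x; apply: hK.
  + by move=> x; apply: h'K.
  + by move=> x y f; apply: hnat.
- constructor; case: eps => h h' hK h'K hnat.
  refine (@NatIso (full_subcategory Q) _
    (functor_comp (full_functor FP) (full_functor GQ)) (functor_id _)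
    (fun x => h (sval x)) (fun x => h' (sval x)) _ _ _).
  + by move=> x; apply: hK.
  + by move=> x; apply: h'K.
  + by move=> x y f; apply: hnat.
Qed.

Section LinearInverse.
Variables (R : pzRingType) (U V : rmodType R) (f : {linear U -> V}).
Variable g : V -> U.
Hypotheses (fK : cancel f g) (gK : cancel g f).

Let gD : {morph g : v w / v + w}.
Proof. by move=> v w; apply: (can_inj fK); rewrite raddfD /= !gK. Qed.
Let gZ v a : g (rscale v a) = rscale (g v) a.
Proof. by apply: (can_inj fK); rewrite rlinearZ !gK. Qed.

Definition linear_inv : {linear V -> U} := rlinear_of gD gZ.
End LinearInverse.

Section RepInverse.
Variables (k : fieldType) (M : premodulation k) (U V : representation M).
Variables (f : rep_hom U V) (g : forall i, {linear V i -> U i}).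
Hypothesis fK : forall i, cancel (f i) (g i).
Hypothesis gK : forall i, cancel (g i) (f i).

(** Applying the injective map f_j and the commutation of f reduces the claim to (f_i (x) id) (g_i
    (x) id) = id, which is functoriality of the tensor product. *)
Lemma rep_inv_comm i j (e : edge i j) (x : rtensor (V i) (pm_bimod i j)) :
  g j (rep_map V e x) = rep_map U e (rtensor_map (g i) x).
Proof.
apply: (can_inj (@fK j)); rewrite gK rep_hom_comm; congr (rep_map V e _).
rewrite -[RHS]/((rtensor_map (f i) \o rtensor_map (g i)) x) -rtensor_map_comp.
have -> : linear_comp (f i) (g i) = linear_id (V i).
  by apply: linear_ext => v; apply: gK.
by rewrite rtensor_map_id.
Qed.
Definition rep_inv : rep_hom V U := RepHom rep_inv_comm.
End RepInverse.

Section NaturalIsomorphisms.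
Variables (k : fieldType) (M : premodulation k).
Local Notation I := (pm_vertex M).
Local Notation B := (sum_bimod (@pm_bimod k M)).
Local Notation T := (tensor_alg B).

Section Unit.
Variable V : representation M.
Local Notation GV := (mod_rep (rep_mod V)).

(** The component at i of the product of the V_j consists of the families supported at i, so
    coordinate i identifies it with V_i. *)
Let ev i (w : vtx_mod (rep_mod V) i) : V i := rep_mod_coord (vtx_incl w) i.
Let evD i : {morph @ev i : v w / v + w}.
Proof. by []. Qed.
Let evZ i w a : @ev i (rscale w a) = rscale (ev w) a.
Proof. by rewrite /ev vtx_inclZ rep_mod_vdeg0 dinjE. Qed.
Let evl i : {linear GV i -> V i} := rlinear_of (@evD i) (@evZ i).

Lemma rep_unit_comm i j (e : edge i j) (x : rtensor (GV i) (pm_bimod i j)) :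
  evl j (rep_map GV e x) = rep_map V e (rtensor_map (evl i) x).
Proof.
move: x; apply: rtensor_ext => [x y|x y|w x]; first by rewrite !raddfD.
  by rewrite rtensor_mapD raddfD.
rewrite rtensor_mapE -(arrE (V := V)) -[LHS]/(rep_mod_coord (vtx_incl _) j).
by rewrite [vtx_incl _]mod_rep_mapE rep_mod_vdeg1 dinjE.
Qed.
Definition rep_unit : rep_hom GV V := RepHom rep_unit_comm.

Lemma dinj_vtx_subproof i (v : V i) :
  vtx_pred (rep_mod V) i (rep_mod_of (dinj (P := fun i => V i : zmodType) v)).
Proof.
apply/eqP; rewrite -[LHS]/(rep_mod_coord _) rep_mod_vdeg0.
by rewrite [rep_mod_coord _ i]dinjE rscale1.
Qed.
Let dv i (v : V i) : vtx_mod (rep_mod V) i := Vtx (dinj_vtx_subproof v).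

Lemma rep_unitK i : cancel (rep_unit i) (@dv i).
Proof.
(* Writing w as w e_i exhibits it as the injection of its coordinate i. *)
move=> w; apply: vtx_incl_inj; rewrite -[RHS]vtx_inclP.
by rewrite -[RHS]/(rep_mod_coord _) rep_mod_vdeg0 rscale1.
Qed.
Lemma rep_unitVK i : cancel (@dv i) (rep_unit i).
Proof. by move=> v; apply: dinjE. Qed.

Definition rep_unit_inv : rep_hom V GV :=
  @rep_inv k M GV V rep_unit
    (fun i => linear_inv (@rep_unitK i) (@rep_unitVK i)) rep_unitK rep_unitVK.
End Unit.

Definition rep_unit_iso :
  nat_iso (functor_comp (mod_to_rep M) (rep_to_mod M)) (functor_id (Rep M)).
Proof.
refine (@NatIso (Rep M) (Rep M) (functor_comp (mod_to_rep M) (rep_to_mod M))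
  (functor_id _) rep_unit rep_unit_inv _ _ _).
- by move=> V; apply: rep_hom_ext => i w; apply: rep_unitK.
- by move=> V; apply: rep_hom_ext => i w; apply: rep_unitVK.
- by move=> U V f; apply: rep_hom_ext.
Defined.

Section Counit.
Variable W : rmodType T.
Local Notation FW := (rep_mod (mod_rep W)).

(** Off the edges x is 0, so the default value 0 of [arr] agrees with the action of x. *)
Lemma vtx_incl_arr i j (w : mod_rep W i) (x : pm_bimod i j) :
  vtx_incl (arr w x) = rscale (vtx_incl w) (vdeg1 x).
Proof.
have [e|ne] := pselect (edge i j); first by rewrite arrE mod_rep_mapE.
have -> : x = 0 by apply: contrapT => x0; apply: ne; exists x.
by rewrite arr0r vdeg1_0 rscale0.
Qed.

(** As 1 is the sum of the orthogonal idempotents e_i, this map from the product of the W e_i to W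
    is bijective, with inverse w |-> (w e_i)_i. *)
Let total (w : FW) : W := \sum_i vtx_incl (rep_mod_coord w i).
Let totalD : {morph total : v w / v + w}.
Proof. by move=> v w; rewrite /total -big_split. Qed.
Let totalZ w t : total (rscale w t) = rscale (total w) t.
Proof.
apply: talg_linear w t => [|w a|w x]; first exact: totalD.
- rewrite /total rep_mod_deg0 rscale_suml; apply: eq_bigr => i _.
  (* For w_i in W e_i, w_i a = w_i e_i a = w_i a_i. *)
  by rewrite [LHS]vtx_inclZ -vdeg0_deg0 -rscaleA vtx_inclP.
- rewrite /total rep_mod_deg1 rscale_suml.
  transitivity (\sum_j \sum_i rscale (vtx_incl (rep_mod_coord w i))
      (vdeg1 (x (i, j) : pm_bimod i j))).
    apply: eq_bigr => j _; rewrite (additive_sum (f := @vtx_incl k M W j)) //.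
    by apply: eq_bigr => i _; apply: vtx_incl_arr.
  (* Summing over j first leaves row i of x, which is e_i x, acting on w_i = w_i e_i. *)
  rewrite exchange_big; apply: eq_bigr => i _ /=.
  by rewrite -[in RHS]vtx_inclP rscaleA vdeg0_deg1 rscale_sumr.
Qed.
Definition mod_counit : {linear FW -> W} := rlinear_of totalD totalZ.

Let coords (w : W) : FW := rep_mod_of (V := mod_rep W) (fun i => vtx_proj i w).

Lemma mod_counitK : cancel mod_counit coords.
Proof.
move=> w; apply: dprodP => i; apply: vtx_incl_inj.
rewrite [LHS]rscale_suml (bigD1 i) //= big1 ?addr0; first exact: vtx_inclP.
(* The other summands vanish: w_j e_i = w_j e_j e_i = 0. *)
move=> j ji; rewrite -vtx_inclP rscaleA /vdeg0 -tdeg0M mul_ainj /ainj.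
by rewrite dinj_neq // dinj0 /tdeg0 scale0r rscale0.
Qed.
Lemma mod_counitVK : cancel coords mod_counit.
Proof.
move=> w; rewrite rlinear_ofE /total.
by rewrite -[RHS]rscale1 -sum_vdeg0 rscale_sumr.
Qed.
Definition mod_counit_inv : {linear W -> FW} :=
  linear_inv mod_counitK mod_counitVK.
End Counit.

Definition mod_counit_iso :
  nat_iso (functor_comp (rep_to_mod M) (mod_to_rep M)) (functor_id (Mod T)).
Proof.
refine (@NatIso (Mod T) (Mod T) (functor_comp (rep_to_mod M) (mod_to_rep M))
  (functor_id _) mod_counit mod_counit_inv _ _ _).
- by move=> V; apply: linear_ext => w; apply: mod_counitK.
- by move=> V; apply: linear_ext => w; apply: mod_counitVK.
- by move=> U V f; apply: linear_ext => u; rewrite /= raddf_sum.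
Defined.
End NaturalIsomorphisms.

(** * Finite generation *)

Definition rsubmod (R : pzRingType) (V : rmodType R) (P : V -> Prop) : Prop :=
  [/\ P 0, forall v w, P v -> P w -> P (v + w) &
      forall v a, P v -> P (rscale v a)].

Lemma rsubmod_sum (R : pzRingType) (V : rmodType R) (P : V -> Prop) J
    (r : seq J) (Q : pred J) (F : J -> V) :
  rsubmod P -> (forall j, P (F j)) -> P (\sum_(j <- r | Q j) F j).
Proof. by move=> [P0 PD _] PF; elim/big_ind: _. Qed.

(** This turns finite generation into an induction principle: a submodule containing s is
    everything. Later arguments then need no coefficients. *)
Lemma fin_genP (R : pzRingType) (V : rmodType R) :
  fin_gen V <-> exists s : seq V, forall P, rsubmod P ->
    (forall g, g \in s -> P g) -> forall v, P v.
Proof.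
split=> [[n [g gV]]|[s sV]].
  exists (map g (enum 'I_n)) => P PV Pg v; have [c ->] := gV v.
  apply: rsubmod_sum => // i; case: PV => _ _; apply.
  by apply: Pg; rewrite map_f ?mem_enum.
(* The principle is applied to the submodule of linear combinations of s. *)
exists (size s), (fun i => s`_i); apply: sV => [|g gs].
  split=> [|v w [c ->] [d ->]|v a [c ->]].
  - by exists (fun=> 0); rewrite big1 // => i _; rewrite rscale0.
  - exists (fun i => c i + d i); rewrite -big_split.
    by apply: eq_bigr => i _; rewrite rscaleDr.
  - exists (fun i => c i * a); rewrite rscale_suml.
    by apply: eq_bigr => i _; rewrite rscaleA.
have lt : (index g s < size s)%N by rewrite index_mem.
(* A generator g is the combination with coefficient 1 at its first occurrence in s and 0
   elsewhere. *)
exists (fun i => (i == Ordinal lt)%:R); rewrite (bigD1 (Ordinal lt)) //= eqxx.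
rewrite rscale1 nth_index // big1 ?addr0 // => i /negPf->.
exact: rscale0.
Qed.

Definition bimod_rmod (R S : pzRingType) (N : bimodType R S) : rmodType S :=
  rmod_of_act (@ractA R S N) (@ract1 R S N) (@ractDl R S N) (@ractDr R S N).

Section FiniteGeneration.
Variables (k : fieldType) (M : premodulation k).
Local Notation I := (pm_vertex M).
Local Notation B := (sum_bimod (@pm_bimod k M)).
Local Notation T := (tensor_alg B).

(** A submodule over the tensor algebra pulls back along the injection of V_i to an A_i-submodule,
    since A_i acts through [vdeg0]. Hence the injected generators of all the V_i suffice. *)
Lemma rep_mod_fin_gen (V : representation M) :
  rep_fin_gen V -> fin_gen (rep_mod V).
Proof.
move=> fgV.
have {fgV}[s sV] : {s : forall i, seq (V i) & forall i P, rsubmod P ->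
    (forall g, g \in s i -> P g) -> forall v, P v}.
  have gs i := cid ((fin_genP (V i)).1 (fgV i)).
  by exists (fun i => sval (gs i)) => i; apply: (svalP (gs i)).
pose inj i (v : V i) : rep_mod V :=
  rep_mod_of (dinj (P := fun i => V i : zmodType) v).
apply/fin_genP; exists (flatten [seq map (@inj i) (s i) | i <- enum I]).
move=> P PV Pg v.
have -> : v = \sum_i inj i (rep_mod_coord v i).
  by rewrite -[LHS](sum_dinj (P := fun i => V i : zmodType)).
apply: rsubmod_sum => // i; have [P0 PD PZ] := PV.
apply: (sV i (fun v => P (inj i v))) => [|g gs].
  split=> [|u w Pu Pw|u a Pu]; rewrite /inj /rep_mod_of.
  - by rewrite dinj0.
  - by rewrite dinjD; apply: PD.
  have -> : dinj (P := fun i => V i : zmodType) (rscale u a) =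
      rscale (inj i u) (vdeg0 a).
    by rewrite -[RHS]/(rep_mod_coord _) rep_mod_vdeg0 [rep_mod_coord _ i]dinjE.
  exact: PZ.
apply: Pg; apply/flatten_mapP; exists i; first by rewrite mem_enum.
exact: map_f.
Qed.

Lemma mod_rep_fin_gen (W : rmodType T) :
  well_founded (@edge k M) ->
  (forall i j, fin_gen (bimod_rmod (@pm_bimod k M i j))) ->
  fin_gen W -> rep_fin_gen (mod_rep W).
Proof.
move=> wf fgM /fin_genP[s sW] j; elim/(well_founded_ind wf): j => j IH.
(* The induction hypothesis gives generators at the predecessors of j only; elsewhere the list is
   empty. *)
have {IH}[u uV] : {u : forall i, seq (vtx_mod W i) & forall i, edge i j ->
    forall P, rsubmod P -> (forall g, g \in u i -> P g) -> forall v, P v}.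
  have gs i : {u : seq (vtx_mod W i) | edge i j -> forall P, rsubmod P ->
      (forall g, g \in u -> P g) -> forall v, P v}.
    have [e|ne] := pselect (edge i j); last by exists [::] => /ne.
    by have /fin_genP/cid[u uV] := IH i e; exists u.
  by exists (fun i => sval (gs i)) => i; apply: (svalP (gs i)).
have {fgM}[m mM] : {m : forall i, seq (@pm_bimod k M i j) & forall i P,
    rsubmod (V := bimod_rmod (pm_bimod i j)) P ->
    (forall g, g \in m i -> P g) -> forall v, P v}.
  have gs i := cid ((fin_genP _).1 (fgM i j)).
  by exists (fun i => sval (gs i)) => i; apply: (svalP (gs i)).
apply/fin_genP; exists (map (@vtx_proj k M W j) s ++
  flatten [seq allpairs (@vtx_arr k M W i j) (u i) (m i) | i <- enum I]).
move=> P PV Pg; have [P0 PD PZ] := PV.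
(* The products of the generators of W e_i and of iMj lie in P; hence so does every product. *)
have Parr i (v : vtx_mod W i) (x : pm_bimod i j) : P (vtx_arr v x).
  have arr0 (w : vtx_mod W i) : vtx_arr w (0 : pm_bimod i j) = 0.
    by apply: vtx_incl_inj; rewrite vtx_arrE vdeg1_0 rscale0.
  have [e|ne] := pselect (edge i j); last first.
    have -> : x = 0 by apply: contrapT => x0; apply: ne; exists x.
    by rewrite arr0.
  (* Quantifying over all x makes the condition on v stable under A_i, since (v a) x = v (a x). *)
  move: v x; apply: (uV i e) => [|g gu].
    split=> [x|v w Pv Pw x|v a Pv x].
    - have -> : vtx_arr (0 : vtx_mod W i) x = 0; last by [].
      by apply: vtx_incl_inj; apply: rscale0l.
    - by rewrite vtx_arrDl; apply: PD.
    - by rewrite vtx_arr_bal.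
  apply: (mM i) => [|y ym].
    split=> [|x y Px Py|x a Px].
    - by rewrite arr0.
    - by rewrite vtx_arrDr; apply: PD.
    - by rewrite vtx_arr_ract; apply: PZ.
  apply: Pg; rewrite mem_cat; apply/orP; right; apply/flatten_mapP.
  by exists i; [rewrite mem_enum|apply: allpairs_f].
suff PW w : P (vtx_proj j w).
  move=> v; have -> : v = vtx_proj j (vtx_incl v); last exact: PW.
  by apply: vtx_incl_inj; rewrite vtx_projK vtx_inclP.
have projD v w' : vtx_proj j (v + w') = vtx_proj j v + vtx_proj j w'.
  by apply: vtx_incl_inj; apply: rscaleDl.
have projZ v a :
    vtx_proj j (rscale v (tdeg0 B a)) = rscale (vtx_proj j v) (a j).
  apply: vtx_incl_inj; rewrite vtx_inclZ !vtx_projK !rscaleA.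
  by rewrite deg0_vdeg0 -vdeg0M mul1r.
(* It remains to see that the w with w e_j in P form a submodule over the whole tensor algebra. *)
move: w; apply: sW => [|g gs]; last first.
  by apply: Pg; rewrite mem_cat map_f.
split=> [|v w Pv Pw|v t].
- have -> : vtx_proj j (0 : W) = 0 by apply: vtx_incl_inj; apply: rscale0l.
  by [].
- by rewrite projD; apply: PD.
move: t v; apply: talg_ind => [t t' IHt IHt'|a|x t IHt] v Pv.
- by rewrite rscaleDr projD; apply: PD; auto.
- by rewrite projZ; apply: PZ.
(* The component of v x at j is a sum of images of arrow maps, which lie in P by [Parr] whatever v
   is. *)
rewrite -rscaleA; apply: IHt.
have -> : vtx_proj j (rscale v (tdeg1 x)) =
    \sum_i vtx_arr (vtx_proj i v) (x (i, j) : pm_bimod i j).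
  apply: vtx_incl_inj; rewrite (additive_sum (f := @vtx_incl k M W j)) //.
  rewrite vtx_projK rscaleA deg1_vdeg0 rscale_sumr; apply: eq_bigr => i _.
  by rewrite [RHS]rscaleA -vdeg1_lact lact1.
exact: rsubmod_sum.
Qed.

Lemma rep_mod_equivalent : equivalent (Rep M) (Mod T).
Proof.
exists (rep_to_mod M), (mod_to_rep M); split; constructor.
  exact: rep_unit_iso.
exact: mod_counit_iso.
Qed.

Lemma rep_mod_fg_equivalent :
  well_founded (@edge k M) ->
  (forall i j, fin_gen (bimod_rmod (@pm_bimod k M i j))) ->
  equivalent (rep_fg M) (mod_fg T).
Proof.
move=> wf fgM; apply: (full_equivalent (F := rep_to_mod M) (G := mod_to_rep M)).
- exact: rep_mod_fin_gen.
- by move=> W; apply: mod_rep_fin_gen.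
- exact: rep_unit_iso.
- exact: mod_counit_iso.
Qed.
End FiniteGeneration.

(** * Acyclic quivers and free bimodules *)

(** Induction on the number of ancestors of y. A predecessor x of y has strictly fewer: its
    ancestors are ancestors of y, while y itself is not one of them, as a path from y to x followed
    by the edge to y would be a cycle. *)
Lemma acyclic_well_founded (T : finType) (e : rel T) :
  (forall c, cycle e c -> c = [::]) -> well_founded e.
Proof.
move=> acyc y; have [n] := ubnP #|[pred x | connect e x y]|.
elim: n y => [//|n IHn] y /ltnSE le; constructor=> x exy; apply: IHn.
apply: leq_trans le; apply: proper_card; apply/properP; split.
  by apply/subsetP=> z; rewrite !inE => /connect_trans; apply; apply: connect1.
exists y; rewrite !inE; first exact: connect0.
apply/negP => /connectP[p yp xE]; have /acyc // : cycle e (y :: p).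
by rewrite /= rcons_path yp -xE.
Qed.

(** If the b_i form a k-basis of A, the b_i (x) 1 generate A (x) B as a right B-module; one copy for
    each element of X suffices. *)
Lemma free_bimod_fin_gen (k : fieldType) (A B : falgType k) (X : finType) :
  fin_gen (bimod_rmod (free_bimod A B X)).
Proof.
pose single x (t : alg_bimod A B) : bimod_rmod (free_bimod A B X) :=
  [ffun y => if y == x then t else 0].
have singleD x : {morph single x : t u / t + u}.
  move=> t u; apply/ffunP => y; rewrite !ffunE.
  by case: eqP => // _; rewrite addr0.
pose b := vbasis {:A}.
apply/fin_genP; exists [seq single x (alg_tens a 1) | x <- enum X, a <- b].
move=> P PV Pg f; have [P0 PD PZ] := PV.
have -> : f = \sum_x single x ((f : {ffun X -> alg_bimod A B}) x).
  apply/ffunP => y; rewrite sum_ffunE (bigD1 y) //= ffunE eqxx big1 ?addr0 //.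
  by move=> x /negPf yx; rewrite ffunE eq_sym yx.
apply: rsubmod_sum => // x; move: (X in single x X).
apply: tens_ind => [|t u Pt Pu|a c].
- by rewrite (additive0 (singleD x)).
- by rewrite singleD; apply: PD.
pose h a' := single x (alg_tens a' c).
have hD : {morph h : a1 a2 / a1 + a2}.
  by move=> a1 a2; rewrite /h -singleD; congr (single x _); apply: tensDl.
rewrite -[single x _]/(h a) (coord_vbasis (memvf a)) (additive_sum _ _ _ hD).
apply: rsubmod_sum => // i; rewrite /h.
set d := coord _ _ _.
(* The scalar d crosses the tensor sign: d b_i (x) c = (b_i (x) 1) (d c). *)
have -> : single x (alg_tens (d *: b`_i) c) =
    rscale (single x (alg_tens b`_i 1)) (d *: c).
  apply/ffunP => y; rewrite !ffunE; case: eqP => _; last by rewrite ract0.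
  by rewrite [RHS]alg_ractE mul1r; apply: tens_bal.
apply: PZ; apply: Pg; apply: allpairs_f; first by rewrite mem_enum.
by apply: mem_nth; rewrite size_tuple.
Qed.

Theorem corollary5p4 (k : fieldType) (Q : quiver) (A : vertex Q -> falgType k) :
  equivalent (Rep (gpa_premodulation A)) (Mod (gen_path_alg A)) /\
  (acyclic Q ->
   equivalent (rep_fg (gpa_premodulation A)) (mod_fg (gen_path_alg A))).
Proof.
split=> [|acyc]; first exact: rep_mod_equivalent.
apply: (rep_mod_fg_equivalent (M := gpa_premodulation A)) => [|i j].
  (* Without arrows from i to j, the free bimodule consists of functions on an empty type and is
     zero. So [edge] is contained in [has_arrow] and inherits its well-foundedness. *)
  move=> j; elim/(well_founded_ind (acyclic_well_founded acyc)): j => j IH.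
  constructor=> i [x x0]; apply: IH; apply: contrapT => /negP noarr; apply: x0.
  apply/ffunP => -[a ea]; case/existsP: noarr; by exists a.
exact: free_bimod_fin_gen.
Qed.
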